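(* Let $A \subseteq M^k$ be a definable set. Then the $\mathrm{acl}$-dimension, the naive topological dimension and the dp-rank of $A$ coincide.
   Context: Setting. $T$ is a complete NIP theory in a multi-sorted language $L$ with a distinguished home sort, $\mathcal M$ is an $|L|^+$-saturated model of $T$, and $M$ is the home sort of $\mathcal M$. ''Definable'' means definable in $\mathcal M$, possibly with parameters. A definable set $A$ has dp-rank greater than $n$ if for $0 \le i \le n$ there are formulas $\phi_i(x,y_i)$ (parameters allowed) and infinite sets $B_i$ of tuples (from the sorts of $y_i$) such that for every $(b_0,\dots,b_n) \in B_0\times\cdots\times B_n$ there is $a \in A$ such that for all $0 \le i \le n$ and $y \in B_i$: $\mathcal M \models \phi_i(a,y)$ if and only if $y=b_i$. A nonempty set has dp-rank at least $0$. $\mathcal M$ is assumed dp-minimal: $M$ has dp-rank $1$. $M$ is equipped with a definable uniform structure $\mathcal B$: a collection of subsets of $M^2$ of the form $\mathcal B=\{\varphi(M^2,\bar c): \bar c \in D\}$ for some formula $\varphi(x,y,\bar z)$ and some definable set $D$, such that (i) $\bigcap \mathcal B$ is the diagonal of $M^2$; (ii) each $U\in\mathcal B$ is symmetric; (iii) for all $U,V \in \mathcal B$ there is $W \in \mathcal B$ with $W \subseteq U\cap V$; (iv) for all $U \in \mathcal B$ there is $V\in\mathcal B$ with $V \circ V \subseteq U$, where $U\circ V=\{(x,z): \exists y\ (x,y)\in U,\ (y,z)\in V\}$. For $x\in M$ put $U[x]=\{y:(x,y)\in U\}$; $M$ has the topology in which a set is open iff it contains some $U[x]$ ($U\in\mathcal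 B$) around each of its points $x$, and $M^k$ has the product topology. It is assumed that $M$ has no isolated points and that every infinite definable subset of $M$ has nonempty interior. Dimensions. The naive topological dimension of a definable $A\subseteq M^k$ is the maximal $l$ for which there is a coordinate projection $\pi: M^k\to M^l$ such that $\pi(A)$ has nonempty interior. For a tuple $\bar a \in M^k$ and a small (of cardinality at most $|L|$) parameter set $C$, $\dim(\bar a/C)$ is the minimal $l$ such that some subtuple $\bar a'$ of $\bar a$ of length $l$ satisfies $\bar a \in \mathrm{acl}(C\bar a')$. The $\mathrm{acl}$-dimension of a $C$-definable set $A$ is $\dim(A)=\max\{\dim(\bar a/C):\bar a\in A\}$; it does not depend on the choice of small $C$ over which $A$ is definable. All these dimensions of the empty set are $-\infty$. *)

(* Defs.v *)
From HB Require Import structures.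
From mathcomp Require Import all_boot.
From mathcomp Require Import boolp classical_sets functions cardinality.
From mathcomp Require Import constructive_ereal topology.

Set Implicit Arguments.
Unset Strict Implicit.
Unset Printing Implicit Defensive.

Local Open Scope classical_set_scope.

Record language := Language {
  lsort : Type;
  fsym : Type;
  fdom : fsym -> seq lsort;
  fcod : fsym -> lsort;
  rsym : Type;
  rdom : rsym -> seq lsort }.

(* A variable context is a type [V] of variables together with their sorts
   [x : V -> lsort L].  The sum of two contexts and the extension of a context
   by one variable live on [V + W] and [option V]. *)
Definition csum S V W (x : V -> S) (y : W -> S) (u : V + W) : S :=
  match u with inl v => x v | inr w => y w end.

Definition ccons S V (s : S) (x : V -> S) (o : option V) : S :=
  if o is Some v then x v else s.

Definition cseq S (l : seq S) : 'I_(size l) -> S := tnth (in_tuple l).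
Arguments cseq {S} l.

Inductive term (L : language) V (x : V -> lsort L) : lsort L -> Type :=
| Var v : term x (x v)
| App (f : fsym L) (t : forall i, term x (cseq (fdom f) i)) : term x (fcod f).

Inductive formula (L : language) V (x : V -> lsort L) : Type :=
| Bot
| Eq s (t u : term x s)
| Rel (r : rsym L) (t : forall i, term x (cseq (rdom r) i))
| Imp (p q : formula x)
| All s (p : formula (ccons s x)).

Arguments Bot {L V x}.

Definition Neg L V (x : V -> lsort L) (p : formula x) : formula x := Imp p Bot.

Definition sentence L := formula (of_void (lsort L)).

Record structure L := Structure {
  carrier :> lsort L -> Type;
  finterp : forall f, (forall i, carrier (cseq (fdom f) i)) -> carrier (fcod f);
  rinterp : forall r, (forall i, carrier (cseq (rdom r) i)) -> Prop }.

Definition env L (M : structure L) V (x : V -> lsort L) := forall v, M (x v).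

Definition ecat L (M : structure L) V W (x : V -> lsort L) (y : W -> lsort L)
    (a : env M x) (b : env M y) : env M (csum x y) :=
  fun u => match u with inl v => a v | inr w => b w end.

Definition econs L (M : structure L) V s (m : M s) (x : V -> lsort L)
    (a : env M x) : env M (ccons s x) :=
  fun o => match o with Some v => a v | None => m end.

Fixpoint eval L (M : structure L) V (x : V -> lsort L) (a : env M x)
    s (t : term x s) : M s :=
  match t with
  | Var v => a v
  | App f t => finterp (fun i => eval a (t i))
  end.

Fixpoint sat L (M : structure L) V (x : V -> lsort L) (p : formula x) :
    env M x -> Prop :=
  match p with
  | Bot => fun=> False
  | Eq _ t u => fun a => eval a t = eval a u
  | Rel r t => fun a => rinterp (fun i => eval a (t i))
  | Imp p q => fun a => sat p a -> sat q a
  | All s p => fun a => forall m : M s, sat p (econs m a)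
  end.

Definition truth L (M : structure L) (s : sentence L) : Prop :=
  sat s (fun v : void => match v with end : M (of_void (lsort L) v)).

Definition model L (T : set (sentence L)) (N : structure L) :=
  forall s, T s -> truth N s.

Definition entails L (T : set (sentence L)) (s : sentence L) :=
  forall N, model T N -> truth N s.

Definition complete_theory L (T : set (sentence L)) :=
  (exists N, model T N) /\ forall s, entails T s \/ entails T (Neg s).

Definition NIP L (T : set (sentence L)) :=
  forall n m (x : 'I_n -> lsort L) (y : 'I_m -> lsort L) (p : formula (csum x y))
         (N : structure L), model T N ->
  ~ exists (a : nat -> env N x) (b : set nat -> env N y),
      forall i I, sat p (ecat (a i) (b I)) <-> I i.

(* A formula in the context [x], with parameters plugged in for finitely many
   further variables. *)
Record pformula L (M : structure L) V (x : V -> lsort L) := PFormula {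
  pf_n : nat;
  pf_ctx : 'I_pf_n -> lsort L;
  pf_formula : formula (csum x pf_ctx);
  pf_par : env M pf_ctx }.
Arguments pf_ctx {L M V x} p j.
Arguments pf_par {L M V x} p v.

Definition psat L (M : structure L) V (x : V -> lsort L) (p : pformula M x)
    (a : env M x) : Prop :=
  sat (pf_formula p) (ecat a (pf_par p)).

Definition elt L (M : structure L) := {s : lsort L & M s}.

Definition formula_over L (M : structure L) (C : set (elt M))
    V (x : V -> lsort L) (p : pformula M x) :=
  forall j, C (existT _ (pf_ctx p j) (pf_par p j)).

Definition definable_over L (M : structure L) (C : set (elt M))
    V (x : V -> lsort L) (A : set (env M x)) :=
  exists2 p : pformula M x, formula_over C p & A = [set a | psat p a].

Definition definable L (M : structure L) V (x : V -> lsort L)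
    (A : set (env M x)) := definable_over [set: elt M] A.

(* [|C| <= |L|], where as usual [|L|] is the (infinite) number of L-formulas,
   written with countably many variables [(s, i)] of each sort [s]. *)
Definition small L (M : structure L) (C : set (elt M)) : Prop :=
  (C #<= [set: formula (fun v : lsort L * nat => v.1)])%card.

(* [|L|^+]-saturation: a partial type in finitely many variables over a
   parameter set of cardinality at most [|L|] is realized. *)
Definition saturated L (M : structure L) :=
  forall (C : set (elt M)) n (x : 'I_n -> lsort L) (Sigma : set (pformula M x)),
  small C -> (forall p, Sigma p -> formula_over C p) ->
  (forall F, F `<=` Sigma -> finite_set F ->
     exists a, forall p, F p -> psat p a) ->
  exists a, forall p, Sigma p -> psat p a.

(* The supremum in {-oo} U nat U {+oo}; it is -oo exactly for the empty set and
   is a maximum whenever it is finite. *)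
Definition nat_sup (P : set nat) : \bar nat :=
  if pselect (exists n, P n /\ forall m, P m -> m <= n) is left e then (sval (cid e))%:E
  else if `[< P = set0 >] then -oo%E else +oo%E.

Definition dp_rank_gt L (M : structure L) V (x : V -> lsort L)
    (A : set (env M x)) (n : nat) :=
  exists (m : 'I_n.+1 -> nat) (y : forall i, 'I_(m i) -> lsort L)
         (phi : forall i, pformula M (csum x (y i)))
         (B : forall i, set (env M (y i))),
  (forall i, infinite_set (B i)) /\
  forall b : (forall i, env M (y i)), (forall i, B i (b i)) ->
  exists2 a, A a &
    forall i c, B i c -> (psat (phi i) (ecat a c) <-> c = b i).

Definition dp_rank_ge L (M : structure L) V (x : V -> lsort L)
    (A : set (env M x)) (n : nat) :=
  if n is n'.+1 then dp_rank_gt A n' else A !=set0.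

Definition dp_rank L (M : structure L) V (x : V -> lsort L)
    (A : set (env M x)) : \bar nat := nat_sup [set n | dp_rank_ge A n].

Definition acl L (M : structure L) (C : set (elt M)) : set (elt M) :=
  [set e | exists D : set (env M (fun _ : 'I_1 => projT1 e)),
     [/\ definable_over C D, finite_set D & D (fun=> projT2 e)]].

(* The context of [k] variables of sort [h], so that [env M (pow h k)] is the
   k-th Cartesian power of [M h]. *)
Definition pow L (h : lsort L) k : 'I_k -> lsort L := fun=> h.
Arguments pow {L} h k.

(* A subtuple is given by its set [I] of positions; the default value [k] is
   the one of the full tuple [I = setT]. *)
Definition dim_tuple L (M : structure L) (h : lsort L) k (C : set (elt M))
    (a : env M (pow h k)) : nat :=
  \big[minn/k]_(I : {set 'I_k} |
      `[< forall i, acl (C `|` [set existT _ h (a j) | j in [set` I]])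
                        (existT _ h (a i)) >]) #|I|.

Definition acl_dim L (M : structure L) (h : lsort L) k (C : set (elt M))
    (A : set (env M (pow h k))) : \bar nat := nat_sup [set dim_tuple C a | a in A].

Local Open Scope relation_scope.

(* [ub_neq0] is redundant as soon as [T] has two points: an empty intersection
   is not the diagonal. *)
Record uniform_base (T : Type) := UniformBase {
  ub_sets : set (set (T * T));
  ub_neq0 : ub_sets !=set0;
  ub_diag : \bigcap_(U in ub_sets) U = diagonal;
  ub_sym : forall U, ub_sets U -> U^-1 = U;
  ub_meet : forall U V, ub_sets U -> ub_sets V ->
    exists2 W, ub_sets W & W `<=` U `&` V;
  ub_split : forall U, ub_sets U -> exists2 V, ub_sets V & V \; V `<=` U }.

Local Close Scope relation_scope.

(* An alias of [T] carrying the topology whose open sets are the [uopen] ones. *)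
Definition uspace T (B : uniform_base T) : Type := T.

Definition uopen T (B : uniform_base T) (O : set (uspace B)) :=
  forall x, O x -> exists2 U, ub_sets B U & xsection U x `<=` O.

Lemma uopenT T (B : uniform_base T) : uopen [set: uspace B].
Proof. by move=> x _; have [U BU] := ub_neq0 B; exists U. Qed.

Lemma uopenI T (B : uniform_base T) : setI_closed (@uopen T B).
Proof.
move=> O P oO oP x [Ox Px].
have [U BU UO] := oO x Ox; have [V BV VP] := oP x Px.
have [W BW WUV] := ub_meet BU BV; exists W => // y.
rewrite /xsection /= in_setE => /WUV[Uxy Vxy].
by split; [apply: UO | apply: VP]; rewrite /xsection /= in_setE.
Qed.

Lemma uopen_bigU T (B : uniform_base T) I (f : I -> set (uspace B)) :
  (forall i, uopen (f i)) -> uopen (\bigcup_i f i).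
Proof.
move=> of_ x [i _ fx]; have [U BU Uf] := of_ i x fx.
by exists U => // y Uy; exists i => //; apply: Uf.
Qed.

HB.instance Definition _ T (B : uniform_base T) := gen_eqMixin (uspace B).
HB.instance Definition _ T (B : uniform_base T) := gen_choiceMixin (uspace B).
HB.instance Definition _ T (B : uniform_base T) :=
  isOpenTopological.Build (uspace B) (@uopenT T B) (@uopenI T B)
    (@uopen_bigU T B).

Definition upow T (B : uniform_base T) (k : nat) : topologicalType :=
  prod_topology (fun _ : 'I_k => uspace B).

Definition pair_env L (M : structure L) (h : lsort L) (a : M h * M h) :
    env M (pow h 2) := fun i => if i == ord0 then a.1 else a.2.

Definition definable_family L (M : structure L) (h : lsort L)
    (B : set (set (M h * M h))) :=
  exists n (z : 'I_n -> lsort L) (phi : formula (csum (pow h 2) z))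
         (D : set (env M z)), definable D /\
    B = [set [set a | sat phi (ecat (pair_env a) c)] | c in D].

Definition naive_dim L (M : structure L) (h : lsort L) (B : uniform_base (M h))
    k (A : set (env M (pow h k))) : \bar nat :=
  nat_sup [set l | exists2 f : 'I_l -> 'I_k, injective f &
    interior [set ((fun i => a (f i)) : upow B l) | a in A] !=set0].

Definition definable1 L (M : structure L) (h : lsort L) (X : set (M h)) :=
  definable [set a : env M (pow h 1) | X (a ord0)].

(* Main.v *)
(* Fix a small set [C] over which [A] is definable.

   naive <= dp.  A box inside a coordinate projection of [A] contains a product
   of infinite sets, hence a pattern of that depth.

   dp <= acl.  If all points of [A] have acl-dimension at most [d], then by
   compactness [A] is a finite union of definable sets with finite fibres over
   [d] of their coordinates; by Ramsey it is enough to bound the depth of a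
   pattern in such a set, by induction on [d].  Write a point as [(e, x)] with
   [e] in [M], and assume a pattern with [d + 2] rows.  By induction the fibre
   over [e] has no pattern in the rows other than [t], whatever [t] is, so that
   [e] distinguishes positions in these rows.  Choosing a minimal set of rows
   whose position is seen by [e] produces two disjoint groups of rows whose
   positions are seen independently: a pattern with two rows in [M],
   contradicting dp-minimality.

   acl <= naive.  Let [a] be a tuple none of whose coordinates is algebraic over
   [C] and the others, and [X] a [C]-definable set containing [a].  If all
   parameters [c] of the uniform structure were in [C], then one could take a
   neighbourhood of [(a_2, ..., a_l)] in the fibre of [X] over [a_1]; it works for
   infinitely many values of [a_1], so [X] has interior.  In general, any two
   uniform structures of the definable family agree at all but boundedly many
   points.  For a pair [c, c'] that disagrees at the maximal number of points,
   the common germ at any other point takes finitely many values (by Bollobas'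
   theorem on set pairs), so using such pairs instead of the given parameters
   makes the argument invariant over [C]. *)
Require Import Defs.
From mathcomp Require Import all_boot zify.
From mathcomp Require Import boolp classical_sets functions cardinality filter.
From mathcomp Require Import constructive_ereal topology.

Set Implicit Arguments.
Unset Strict Implicit.
Unset Printing Implicit Defensive.

Local Open Scope classical_set_scope.

Local Notation eval := Defs.eval.

(** * Definability without parameters *)

Section Substitution.
Variables (L : language) (M : structure L).

Fixpoint tsubst V W (x : V -> lsort L) (y : W -> lsort L)
    (th : forall v, term y (x v)) s (t : term x s) : term y s :=
  match t with
  | Var v => th v
  | App f t => App (fun i => tsubst th (t i))
  end.

Lemma eval_tsubst V W (x : V -> lsort L) (y : W -> lsort L)
    (th : forall v, term y (x v)) s (t : term x s) (b : env M y) :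
  eval b (tsubst th t) = eval (fun v => eval b (th v)) t.
Proof. by elim: t => //= f t IH; congr finterp; apply: functional_extensionality_dep. Qed.

Definition tlift V W (x : V -> lsort L) (y : W -> lsort L)
    (th : forall v, term y (x v)) s (o : option V) :
    term (ccons s y) (ccons s x o) :=
  match o with
  | Some v => tsubst (fun w => Var (ccons s y) (Some w)) (th v)
  | None => Var (ccons s y) None
  end.

Fixpoint fsubst V (x : V -> lsort L) (p : formula x) :
    forall W (y : W -> lsort L), (forall v, term y (x v)) -> formula y :=
  match p with
  | Bot => fun _ _ _ => Bot
  | Eq _ t u => fun _ _ th => Eq (tsubst th t) (tsubst th u)
  | Rel r t => fun _ _ th => Rel (fun i => tsubst th (t i))
  | Imp p q => fun _ _ th => Imp (fsubst p th) (fsubst q th)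
  | All s p => fun _ _ th => All (fsubst p (tlift th s))
  end.

Lemma sat_fsubst V (x : V -> lsort L) (p : formula x) W (y : W -> lsort L)
    (th : forall v, term y (x v)) (b : env M y) :
  sat (fsubst p th) b = sat p (fun v => eval b (th v)).
Proof.
elim: p W y th b => //= {V x}.
- by move=> V x s t u W y th b; rewrite !eval_tsubst.
- move=> V x r t W y th b; congr (rinterp _).
  by apply: functional_extensionality_dep => i; rewrite eval_tsubst.
- by move=> V x p IHp q IHq W y th b; rewrite IHp IHq.
- move=> V x s p IHp W y th b; apply/eq_forall => m; rewrite IHp; congr (sat p).
  by apply: functional_extensionality_dep => -[v|] //=; rewrite eval_tsubst.
Qed.

End Substitution.

Section Definability.
Variables (L : language) (M : structure L).
Local Notation S := (lsort L).

(* Definability is without parameters from here on: parameters are kept as an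
   extra context of variables. *)
Definition tdef V (x : V -> S) s (f : env M x -> M s) :=
  exists t : term x s, forall a, f a = eval a t.

Definition tmap V W (x : V -> S) (y : W -> S) (f : env M x -> env M y) :=
  forall w, tdef (fun a => f a w).

Definition fdef V (x : V -> S) (P : env M x -> Prop) :=
  exists p : formula x, forall a, P a = sat p a.

Lemma tdef_var V (x : V -> S) v : tdef (fun a : env M x => a v).
Proof. by exists (Var x v). Qed.

End Definability.

Ltac tvar := cbn beta iota delta [ecat econs]; match goal with
  |- tdef (fun a => a ?v) => exact (tdef_var _ _ v) end.

Section Closure.
Variables (L : language) (M : structure L).
Local Notation S := (lsort L).

Lemma tdef_cast V (x : V -> S) W (y : W -> S) w w' (e : w = w')
    (f : env M x -> M (y w)) : tdef f ->
  tdef (fun a => eq_rect w (fun u => M (y u)) (f a) w' e).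
Proof. by case: w' / e. Qed.

Lemma dep_choice I (T : I -> Type) (R : forall i, T i -> Prop) :
  (forall i, exists t, R i t) -> exists f : forall i, T i, forall i, R i (f i).
Proof. by move=> H; exists (fun i => sval (cid (H i))) => i; case: cid. Qed.

Lemma fdef_tmap V W (x : V -> S) (y : W -> S) (P : env M y -> Prop)
    (f : env M x -> env M y) :
  fdef P -> tmap f -> fdef (fun a => P (f a)).
Proof.
move=> [p Pp] /dep_choice[th fth]; exists (fsubst p th) => a.
rewrite sat_fsubst Pp; congr (sat p).
by apply: functional_extensionality_dep => w; apply: fth.
Qed.

Lemma tdef_tmap V W (x : V -> S) (y : W -> S) s (t : env M y -> M s)
    (f : env M x -> env M y) :
  tdef t -> tmap f -> tdef (fun a => t (f a)).
Proof.
move=> [t' t't] /dep_choice[th fth]; exists (tsubst th t') => a.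
rewrite eval_tsubst t't; congr (eval _ t').
by apply: functional_extensionality_dep => w; apply: fth.
Qed.

Lemma fdef_ext V (x : V -> S) (P Q : env M x -> Prop) :
  (forall a, P a <-> Q a) -> fdef P -> fdef Q.
Proof.
by move=> PQ [p Pp]; exists p => a; rewrite -Pp; apply: propext; split=> /PQ.
Qed.

Lemma fdef_False V (x : V -> S) : fdef (fun _ : env M x => False).
Proof. by exists Bot. Qed.

Lemma fdef_imp V (x : V -> S) (P Q : env M x -> Prop) :
  fdef P -> fdef Q -> fdef (fun a => P a -> Q a).
Proof. by move=> [p Pp] [q Qq]; exists (Imp p q) => a /=; rewrite -Pp -Qq. Qed.

Lemma fdef_not V (x : V -> S) (P : env M x -> Prop) :
  fdef P -> fdef (fun a => ~ P a).
Proof. by move=> dP; apply: fdef_imp (@fdef_False V x). Qed.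

(** Excluded middle turns a condition without variables into truth or falsity, so conditions on
    indices may occur inside definable predicates. *)
Lemma fdef_const V (x : V -> S) (Q : Prop) : fdef (fun _ : env M x => Q).
Proof.
have [q|nq] := EM Q; last by apply: fdef_ext (fdef_False x) => a.
by apply: fdef_ext (fdef_not (fdef_False x)) => a; split=> // _ [].
Qed.

Lemma fdef_or V (x : V -> S) (P Q : env M x -> Prop) :
  fdef P -> fdef Q -> fdef (fun a => P a \/ Q a).
Proof.
move=> dP dQ; apply: fdef_ext (fdef_imp (fdef_not dP) dQ) => a.
by split=> [PQ|[]//]; have [?|/PQ] := EM (P a); [left|right].
Qed.

Lemma fdef_and V (x : V -> S) (P Q : env M x -> Prop) :
  fdef P -> fdef Q -> fdef (fun a => P a /\ Q a).
Proof.
move=> dP dQ; apply: fdef_ext (fdef_not (fdef_or (fdef_not dP) (fdef_not dQ))) => a.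
by rewrite -not_andE notK.
Qed.

Lemma fdef_iff V (x : V -> S) (P Q : env M x -> Prop) :
  fdef P -> fdef Q -> fdef (fun a => P a <-> Q a).
Proof. by move=> dP dQ; apply: fdef_and; apply: fdef_imp. Qed.

Lemma fdef_eq V (x : V -> S) s (f g : env M x -> M s) :
  tdef f -> tdef g -> fdef (fun a => f a = g a).
Proof. by move=> [t ft] [u gu]; exists (Eq t u) => a /=; rewrite -ft -gu. Qed.

Lemma fdef_all V (x : V -> S) s (P : env M x -> M s -> Prop) :
  fdef (fun a : env M (ccons s x) => P (fun v => a (Some v)) (a None)) ->
  fdef (fun a => forall m, P a m).
Proof.
by move=> [p Pp]; exists (All p) => a /=; apply/eq_forall => m; rewrite -Pp.
Qed.

Lemma fdef_ex V (x : V -> S) s (P : env M x -> M s -> Prop) :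
  fdef (fun a : env M (ccons s x) => P (fun v => a (Some v)) (a None)) ->
  fdef (fun a => exists m, P a m).
Proof.
move=> dP; apply: fdef_ext (fdef_not (fdef_all (P := fun a m => ~ P a m) (fdef_not dP))).
by move=> a; rewrite forallNE notK.
Qed.

Lemma fdef_forall_seq V (x : V -> S) I (r : seq I) (P : I -> env M x -> Prop) :
  (forall i, fdef (P i)) -> fdef (fun a => \big[and/True]_(i <- r) P i a).
Proof.
move=> dP; elim: r => [|i r IH].
  by apply: fdef_ext (fdef_const x True) => a; rewrite big_nil.
by apply: fdef_ext (fdef_and (dP i) IH) => a; rewrite big_cons.
Qed.

Lemma fdef_forall V (x : V -> S) (I : finType) (P : I -> env M x -> Prop) :
  (forall i, fdef (P i)) -> fdef (fun a => forall i, P i a).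
Proof.
move=> dP; apply: fdef_ext (fdef_forall_seq (enum I) dP) => a.
have H r : \big[and/True]_(i <- r) P i a <-> forall i, i \in r -> P i a.
  elim: r => [|i r IH]; first by rewrite big_nil.
  rewrite big_cons IH; split=> [[Pi Pr] j|PP].
    by rewrite inE => /orP[/eqP->|/Pr].
  by split=> [|j jr]; apply: PP; rewrite inE ?eqxx ?jr ?orbT.
by rewrite H; split=> PP i; [apply: PP; rewrite mem_enum|].
Qed.

Lemma fdef_exists V (x : V -> S) (I : finType) (P : I -> env M x -> Prop) :
  (forall i, fdef (P i)) -> fdef (fun a => exists i, P i a).
Proof.
move=> dP; apply: fdef_ext (fdef_not (fdef_forall (fun i => fdef_not (dP i)))) => a.
by rewrite forallNE notK.
Qed.

(* A tuple of variables of finite type [V] is encoded as a tuple indexed by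
   ['I_#|V|], the only contexts in which [saturated] and [dp_rank] speak. *)
Definition octx (V : finType) (y : V -> S) (i : 'I_#|V|) : S := y (enum_val i).

Definition to_ord (V : finType) (y : V -> S) (b : env M y) : env M (octx y) :=
  fun i => b (enum_val i).

Definition of_ord (V : finType) (y : V -> S) (b : env M (octx y)) : env M y :=
  fun v => eq_rect _ (fun w => M (y w)) (b (enum_rank v)) v (enum_rankK v).

Lemma eq_rect_env V (y : V -> S) (b : env M y) v w (e : v = w) :
  eq_rect v (fun w => M (y w)) (b v) w e = b w.
Proof. by case: w / e. Qed.

Lemma to_ordK (V : finType) (y : V -> S) : cancel (@to_ord V y) (@of_ord V y).
Proof.
move=> b; apply: functional_extensionality_dep => v.
exact: (eq_rect_env b (enum_rankK v)).
Qed.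

Lemma tmap_of_ord (V : finType) (y : V -> S) : tmap (@of_ord V y).
Proof. by move=> v; apply: tdef_cast; tvar. Qed.

Definition glue n (y : 'I_n.+1 -> S) (m : M (y ord0))
    (b : env M (fun j => y (lift ord0 j))) : env M y := fun i =>
  match unliftP ord0 i with
  | UnliftSome j e => eq_rect_r (fun i => M (y i)) (b j) e
  | UnliftNone e => eq_rect_r (fun i => M (y i)) m e
  end.

Lemma glueE n (y : 'I_n.+1 -> S) (b : env M y) :
  glue (b ord0) (fun j => b (lift ord0 j)) = b.
Proof.
apply: functional_extensionality_dep => i; rewrite /glue.
by case: (unliftP ord0 i) => [j e|e]; exact: (eq_rect_env b (esym e)).
Qed.

Definition fdef2 V W (x : V -> S) (y : W -> S) (R : env M x -> env M y -> Prop) :=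
  fdef (fun a : env M (csum x y) => R (fun v => a (inl v)) (fun w => a (inr w))).

(** The syntax binds one variable at a time: [ord0] is split off and the rest of the block is
    handled by induction. *)
Lemma fdef_all_ord V (x : V -> S) n (y : 'I_n -> S) (P : env M x -> env M y -> Prop) :
  fdef2 P -> fdef (fun a => forall b, P a b).
Proof.
elim: n => [|n IH] in V x y P *.
  move=> dP; have b0 : env M y by case.
  apply: fdef_ext (fdef_tmap (f := fun a => ecat a b0) dP _).
    move=> a; split=> [Pa b|]; last exact.
    by have -> // : b = b0; apply: functional_extensionality_dep; case.
  by case=> [v|[]//]; tvar.
move=> dP; apply: (@fdef_ext _ _ (fun a => forall m b, P a (glue m b))).
  by move=> a; split=> Pa b //; rewrite -(glueE b).
apply: fdef_all; apply: IH.
apply: (fdef_tmap (x := csum (ccons (y ord0) x) (fun j => y (lift ord0 j)))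
  (f := fun a => ecat (fun v => a (inl (Some v)))
  (glue (a (inl None)) (fun j => a (inr j)))) dP).
case=> [v|i] /=; first tvar.
by rewrite /glue; case: (unliftP ord0 i) => [j e|e]; apply: tdef_cast; tvar.
Qed.

Lemma fdef_all_env V (x : V -> S) (W : finType) (y : W -> S)
    (P : env M x -> env M y -> Prop) :
  fdef2 P -> fdef (fun a => forall b, P a b).
Proof.
move=> dP; apply: (@fdef_ext _ _ (fun a => forall b, P a (of_ord b))).
  by move=> a; split=> Pa b //; rewrite -(to_ordK b).
apply: fdef_all_ord.
apply: (fdef_tmap (x := csum x (octx y))
  (f := fun a => ecat (fun v => a (inl v)) (of_ord (fun j => a (inr j)))) dP).
by case=> [v|i] /=; [tvar|apply: tdef_cast; tvar].
Qed.

Lemma fdef_ex_env V (x : V -> S) (W : finType) (y : W -> S)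
    (P : env M x -> env M y -> Prop) :
  fdef2 P -> fdef (fun a => exists b, P a b).
Proof.
move=> dP; apply: fdef_ext (fdef_not (fdef_all_env (P := fun a m => ~ P a m) (fdef_not dP))).
by move=> a; rewrite forallNE notK.
Qed.

Lemma tmap_ecat V W Z (x : V -> S) (y : W -> S) (z : Z -> S)
    (f : env M z -> env M x) (g : env M z -> env M y) :
  tmap f -> tmap g -> tmap (fun a => ecat (f a) (g a)).
Proof. by move=> tf tg [v|v]; [exact: (tf v)|exact: (tg v)]. Qed.

Lemma fdef2_app V W Z (x : V -> S) (y : W -> S) (z : Z -> S)
    (R : env M x -> env M y -> Prop) (f : env M z -> env M x) (g : env M z -> env M y) :
  fdef2 R -> tmap f -> tmap g -> fdef (fun a => R (f a) (g a)).
Proof.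
by move=> dR tf tg; exact (fdef_tmap dR (tmap_ecat tf tg)).
Qed.

Definition fdef3 V W Z (x : V -> S) (y : W -> S) (z : Z -> S)
    (R : env M x -> env M y -> env M z -> Prop) :=
  fdef2 (fun a : env M (csum x y) => R (fun v => a (inl v)) (fun w => a (inr w))).

Lemma fdef3_app V W Z U (x : V -> S) (y : W -> S) (z : Z -> S) (u : U -> S)
    (R : env M x -> env M y -> env M z -> Prop) (f : env M u -> env M x)
    (g : env M u -> env M y) (k : env M u -> env M z) :
  fdef3 R -> tmap f -> tmap g -> tmap k -> fdef (fun a => R (f a) (g a) (k a)).
Proof.
by move=> dR tf tg tk; exact (fdef2_app (R := fun ab : env M (csum x y) =>
  R (fun v => ab (inl v)) (fun w => ab (inr w))) dR (tmap_ecat tf tg) tk).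
Qed.

Lemma fdef_eq_env V (x : V -> S) (W : finType) (y : W -> S) (f g : env M x -> env M y) :
  tmap f -> tmap g -> fdef (fun a => f a = g a).
Proof.
move=> tf tg; apply: (@fdef_ext _ _ (fun a => forall w, f a w = g a w)).
  by move=> a; split=> [|->//]; apply: functional_extensionality_dep.
by apply: fdef_forall => w; apply: fdef_eq.
Qed.

Lemma fdef2I V W (x : V -> S) (y : W -> S) (R : env M x -> env M y -> Prop) :
  fdef (fun a : env M (csum x y) => R (fun v => a (inl v)) (fun w => a (inr w))) ->
  fdef2 R.
Proof. by []. Qed.

End Closure.

Ltac tm :=
  let w := fresh "w" in
  intro w; cbv beta; try solve [tvar]; try (destruct w; cbv beta; solve [tvar]).

Ltac fd1 := cbv beta; lazymatch goal with
  | |- fdef2 _ => apply fdef2I; cbv beta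
  | |- fdef3 _ => apply fdef2I; cbv beta
  | |- fdef (fun _ => ?Q) => apply fdef_const
  | |- fdef (fun a => @?A a /\ @?B a) => apply (@fdef_and _ _ _ _ A B)
  | |- fdef (fun a => @?A a \/ @?B a) => apply (@fdef_or _ _ _ _ A B)
  | |- fdef (fun a => ~ @?A a) => apply (@fdef_not _ _ _ _ A)
  | |- fdef (fun a => @?A a <-> @?B a) => apply (@fdef_iff _ _ _ _ A B)
  | |- fdef (fun a => @?A a -> @?B a) => apply (@fdef_imp _ _ _ _ A B)
  | |- fdef (fun a => forall b : env _ _, @?P a b) =>
      apply (fdef_all_env (P := P)); apply fdef2I; cbv beta
  | |- fdef (fun a => exists b : env _ _, @?P a b) =>
      apply (fdef_ex_env (P := P)); apply fdef2I; cbv beta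
  | |- fdef (fun a => forall b : carrier _ _, @?P a b) =>
      apply (@fdef_all _ _ _ _ _ P); cbv beta
  | |- fdef (fun a => exists b : carrier _ _, @?P a b) =>
      apply (@fdef_ex _ _ _ _ _ P); cbv beta
  | |- fdef (fun a => forall i : _, @?P a i) =>
      apply (@fdef_forall _ _ _ _ _ (fun i a => P a i)); let i := fresh "i" in intro i
  | |- fdef (fun a => exists i : _, @?P a i) =>
      apply (@fdef_exists _ _ _ _ _ (fun i a => P a i)); let i := fresh "i" in intro i
  end; cbv beta.

Ltac fapp := cbv beta; match goal with
  | H : fdef ?R |- fdef (fun a => ?R (@?f a)) =>
      apply (fdef_tmap (f := f) H)
  | H : fdef2 ?R |- fdef (fun a => ?R (@?f a) (@?g a)) =>
      apply (fdef2_app (f := f) (g := g) H)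
  | H : fdef3 ?R |- fdef (fun a => ?R (@?f a) (@?g a) (@?k a)) =>
      apply (fdef3_app (f := f) (g := g) (k := k) H)
  | H : forall i, fdef3 (@?R i) |- fdef (fun a => _ (@?f a) (@?g a) (@?k a)) =>
      apply (fdef3_app (f := f) (g := g) (k := k) (H _))
  end.

Ltac fd := repeat first [fd1 | fapp]; try solve [tm].

(** * Countable saturation *)

Lemma infinite_injection T (A : set T) : infinite_set A ->
  exists2 f : nat -> T, injective f & forall n, A (f n).
Proof.
move=> infA.
have /choice[g gP] (s : seq {classic T}) : exists x : {classic T}, A x /\ x \notin s.
  apply: contrapT => H; apply: infA; apply: (@sub_finite_set _ _ [set` s]).
    by move=> x Ax /=; apply: contrapT => /negP xs; apply: H; exists x.
  exact: (@finite_seq {classic T}).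
pose l n := iter n (fun s => g s :: s) [::].
exists (g \o l) => [|n]; last by case: (gP (l n)).
have lt m n : m < n -> g (l m) \in l n.
  elim: n => // n IH; rewrite ltnS leq_eqVlt => /orP[/eqP->|/IH] /=.
    exact: mem_head.
  by rewrite inE orbC => ->.
move=> m n /= e; apply/eqP; case: ltngtP => // /lt.
  by rewrite e; apply: contraLR => _; case: (gP (l n)).
by rewrite -e; apply: contraLR => _; case: (gP (l m)).
Qed.

Lemma injection_infinite T (A : set T) (f : nat -> T) :
  injective f -> (forall n, A (f n)) -> infinite_set A.
Proof.
move=> fi fA fin; apply: infinite_nat; rewrite (_ : setT = f @^-1` A).
  by apply: finite_preimage fin => i j _ _; apply: fi.
by apply/esym; rewrite -subTset => n _; apply: fA.
Qed.

(** For fixed [m] this is first-order, unlike finiteness; bounds on the sizes of definable sets are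
    therefore stated as the failure of [atleast m]. *)
Definition atleast m T (D : set T) :=
  exists w : 'I_m -> T, injective w /\ forall j, D (w j).

Lemma atleastS m n T (D E : set T) : m <= n -> D `<=` E -> atleast n D -> atleast m E.
Proof.
move=> mn DE [w [wi wD]]; exists (w \o widen_ord mn); split=> [|j]; last exact/DE/wD.
by move=> i j /wi /(congr1 val) /= ij; apply: val_inj.
Qed.

Lemma infinite_atleast m T (D : set T) : infinite_set D -> atleast m D.
Proof.
by case/infinite_injection => f fi fD; exists (fun j => f j); split=> // i j /fi /val_inj.
Qed.

Lemma seq_atleast T (D : set T) (s : seq {classic T}) : uniq s ->
  (forall x, x \in s -> D x) -> atleast (size s) D.
Proof.
move=> us sD; exists (fun j => tnth (in_tuple s) j); split=> [i j|j]; last first.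
  by apply: sD; apply: mem_tnth.
by move/tuple_uniqP: (us : uniq (in_tuple s)) => /[apply].
Qed.

Lemma atleast0 T (D : set T) : atleast 0 D.
Proof. exact: (@seq_atleast T D [::]). Qed.

Lemma not_atleast m T (D : set T) : ~ atleast m D ->
  exists s : seq {classic T}, [/\ uniq s, size s < m & forall x, D x <-> x \in s].
Proof.
move=> nD; have /(@finite_seqP {classic T})[s sD] : finite_set D.
  by apply: contrapT => /(infinite_atleast m).
have Ds (x : {classic T}) : D x <-> x \in undup s by rewrite sD mem_undup.
exists (undup s); split=> //; first exact: undup_uniq.
rewrite ltnNge; apply/negP => ms; apply: nD.
by apply: (@atleastS _ _ _ D) ms _ (seq_atleast (undup_uniq s) _) => // x /Ds.
Qed.

Lemma finite_not_atleast T (D : set T) : finite_set D -> exists m, ~ atleast m D.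
Proof.
move=> /(@finite_seqP {classic T})[s ->]; exists (size s).+1 => -[w [wi ws]].
have := @uniq_leq_size {classic T} (codom w) s; rewrite size_codom card_ord ltnn.
move=> H; suff: false by []; apply: H; first by apply/injectiveP.
by move=> _ /codomP[j ->]; apply: ws.
Qed.

Section Saturation.
Variables (L : language) (M : structure L).
Local Notation S := (lsort L).

(** [|L|] is infinite for every language: iterated negations of falsity are distinct formulas, told
    apart by their depth [dpt]. *)
Lemma countable_small (C : set (elt M)) : countable C -> small C.
Proof.
move=> cC; apply: card_le_trans cC _; rewrite -infiniteP => /finite_image.
pose dpt := fix dpt V (x : V -> S) (p : formula x) : nat :=
  match p with Imp p _ => (dpt _ _ p).+1 | _ => 0 end.
move=> /(_ _ (@dpt _ _)) fin; apply: infinite_nat; move: fin.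
rewrite (_ : [set _ | _ in _] = setT) // -subTset => n _ /=.
exists (iter n (@Neg L _ _) Bot) => //.
by elim: n => //= n ->.
Qed.

Lemma definable_overP (C : set (elt M)) V (x : V -> S) (A : set (env M x)) :
  definable_over C A -> exists n (y : 'I_n -> S) (b : env M y)
    (P : env M x -> env M y -> Prop),
    [/\ fdef2 P, forall j, C (existT _ (y j) (b j)) & forall a, A a = P a b].
Proof.
move=> [[n y p b] pC ->]; exists n, y, b, (fun a b => sat p (ecat a b)).
split=> //; exists p => a; congr (sat p _).
by apply: functional_extensionality_dep; case.
Qed.

Lemma definable_fibre (C : set (elt M)) V (x : V -> S) (W : finType) (y : W -> S)
    (P : env M x -> env M y -> Prop) (b : env M y) :
  fdef2 P -> (forall w, C (existT _ (y w) (b w))) ->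
  definable_over C [set a | P a b].
Proof.
move=> dP Cb; have [||p Pp] := @fdef2_app _ M _ _ _ _ _ (csum x (octx y)) P
  (fun a v => a (inl v)) (fun a => of_ord (fun j => a (inr j))) dP.
- by move=> v; tvar.
- by move=> v; apply: tdef_cast; tvar.
exists (PFormula p (to_ord b)); first by move=> j; apply: Cb.
apply/funext => a; rewrite /psat /= -Pp; congr (P _ _).
exact/esym/(to_ordK b).
Qed.

Lemma definable_overS (C D : set (elt M)) V (x : V -> S) (A : set (env M x)) :
  C `<=` D -> definable_over C A -> definable_over D A.
Proof. by move=> CD [p pC ->]; exists p => // j; apply/CD/pC. Qed.

Lemma definable_tmap (C : set (elt M)) V W (x : V -> S) (y : W -> S)
    (f : env M x -> env M y) (A : set (env M y)) :
  tmap f -> definable_over C A -> definable_over C (f @^-1` A).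
Proof.
move=> tf /definable_overP[n [z [b [P [dP bC AP]]]]].
have -> : f @^-1` A = [set a | (fun a => P (f a)) a b].
  by apply/funext => a /=; rewrite /preimage /= AP.
apply: (definable_fibre (P := fun a => P (f a)) _ bC).
apply: (fdef2_app (z := csum x z) (f := fun a => f (fun v => a (inl v))) dP).
  by move=> w; apply: (tdef_tmap (f := fun a v => a (inl v)) (tf w)) => v; tvar.
by move=> j; tvar.
Qed.

Hypothesis M_saturated : saturated M.

(** The sets use countably many parameters in all, hence a small set; as the chain decreases,
    finitely many conditions follow from the one of largest index. *)
Lemma countable_saturation (V : finType) (x : V -> S) (A : nat -> set (env M x)) :
  (forall n, definable (A n)) -> (forall n, A n.+1 `<=` A n) ->
  (forall n, A n !=set0) -> exists a, forall n, A n a.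
Proof.
move=> dA decr ne.
have Aanti m n : m <= n -> A n `<=` A m.
  by elim: n => [|n IH]; [rewrite leqn0 => /eqP->|rewrite leq_eqVlt => /orP[/eqP->//|/IH sub a /decr/sub]].
have /choice[p pP] n : exists p : pformula M (octx x),
    [set a | psat p a] = @of_ord _ _ _ x @^-1` A n.
  have [p _ Ap] := definable_tmap (@tmap_of_ord _ M _ x) (dA n).
  by exists p; rewrite -Ap.
pose C : set (elt M) := \bigcup_n [set existT _ _ (pf_par (p n) j) | j in setT].
have smC : small C.
  apply: countable_small; apply: bigcup_countable; first exact: countableP.
  by move=> n _; apply: finite_set_countable; apply: finite_image; apply: finite_finset.
have [||a aP] := M_saturated (Sigma := range p) smC.
- by move=> _ [n _ <-] j; exists n => //; exists j.
- move=> F Fp /finite_image Ffin.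
  have /choice[idx idxP] (q : pformula M (octx x)) : exists n, F q -> q = p n.
    by have [/Fp[n _ <-]|nF] := pselect (F q); [exists n|exists 0].
  have /finite_seqP[s sF] := Ffin _ idx.
  have [a Aa] := ne (\max_(i <- s) i).
  exists (to_ord a) => q Fq; rewrite (idxP _ Fq).
  have : [set a | psat (p (idx q)) a] (to_ord a).
    rewrite pP /preimage /= to_ordK; apply: Aanti Aa.
    have : [set` s] (idx q) by rewrite -sF; exists q.
    by move=> qs; apply: (leq_bigmax_seq (P := xpredT) (F := id)).
  exact.
exists (of_ord a) => n.
have : [set a | psat (p n) a] a by apply: aP; exists n.
by rewrite pP.
Qed.

End Saturation.

(** * Ramsey's theorem *)

(** Points placed in different segments of length [A] compare by their segments alone. *)
Lemma segment_lt A a a' m m' : a < A -> a' < A -> m <> m' ->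
  (A * m + a < A * m' + a') = (m < m').
Proof. by move=> aA aA'; case: (ltngtP m m') => // mm _; nia. Qed.

Lemma increasing_inj (f : nat -> nat) : {homo f : m n / m < n} -> injective f.
Proof. by move=> fi m n e; apply/eqP; case: ltngtP => // /fi; rewrite e ltnn. Qed.

Section Ramsey.

Lemma frequently_subseq (P : nat -> Prop) :
  (forall n, exists2 m, n <= m & P m) ->
  exists2 h : nat -> nat, {homo h : m n / m < n} & forall n, P (h n).
Proof.
move=> H; have /choice[g gP] n : exists m, n <= m /\ P m by case: (H n) => m; exists m.
exists (fun n => iter n (g \o succn) (g 0)).
  apply: homo_ltn => [|n] /=; first exact: ltn_trans.
  by case: (gP (iter n (g \o succn) (g 0)).+1).
case=> [|n] /=; first by case: (gP 0).
by case: (gP (iter n (g \o succn) (g 0)).+1).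
Qed.

Lemma infinite_pigeonhole (c : finType) (f : nat -> c) :
  exists col, exists2 h : nat -> nat, {homo h : m n / m < n} & forall n, f (h n) = col.
Proof.
have [[col H]|H] := EM (exists col, forall n, exists2 m, n <= m & f m = col).
  by exists col; apply: (@frequently_subseq (fun m => f m = col)).
have /choice[b bP] col : exists b, forall m, b <= m -> f m <> col.
  apply: contrapT => nb; apply: H; exists col => n; apply: contrapT => nm.
  by apply: nb; exists n => m nm' fm; apply: nm; exists m.
have /(bP (f (\max_col b col))) := leq_bigmax (F := b) (f (\max_col b col)).
by [].
Qed.

(** Diagonal argument: thin out repeatedly until the colour of a set depends only on its least
    element, then apply the pigeonhole principle to these colours. *)
Lemma ramsey r (c : finType) (f : seq nat -> c) :
  exists2 h : nat -> nat, {homo h : m n / m < n} &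
    exists col, forall s, sorted ltn s -> size s = r -> f (map h s) = col.
Proof.
elim: r => [|r IH] in f *.
  by exists id => //; exists (f [::]) => -[].
have /choice[step stepP] (h : nat -> nat) : exists p : (nat -> nat) * c,
    {homo p.1 : m n / m < n} /\ forall s, sorted ltn s -> size s = r ->
      f (h 0 :: [seq h (p.1 i).+1 | i <- s]) = p.2.
  have [h' h'i [col hc]] := IH (fun s => f (h 0 :: map (h \o succn) s)).
  by exists (h', col); split=> // s ss sr; rewrite -(hc s) // -map_comp.
(* [H n.+1] is a subsequence of [H n] starting after [H n 0]; sets of size [r.+1] with least element
   [H n 0] and all others in [H n.+1] have colour [col n]. *)
pose H n := iter n (fun h i => h ((step h).1 i).+1) id.
pose col n := (step (H n)).2.
have HS n i : H n.+1 i = H n ((step (H n)).1 i).+1 by [].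
have stepi n : {homo (step (H n)).1 : i j / i < j} by case: (stepP (H n)).
have Hi n : {homo H n : i j / i < j}.
  by elim: n => // n IHn i j ij; rewrite !HS; apply: IHn; rewrite ltnS; apply: stepi.
have Hle n : {mono H n : i j / i < j}.
  move=> i j; apply/idP/idP => [|/Hi//]; apply: contraTT; rewrite -!leqNgt.
  by rewrite leq_eqVlt => /orP[/eqP->//|/Hi/ltnW].
pose a n := H n 0.
have ai : {homo a : m n / m < n}.
  by apply: homo_ltn => [|n]; [exact: ltn_trans|rewrite /a HS; apply: Hi].
have aH n m : n < m -> exists k, a m = H n.+1 k.
  rewrite /a; elim: m 0 => // m IHm i; rewrite ltnS leq_eqVlt => /orP[/eqP->|/IHm nm].
    by exists i.
  by rewrite HS; apply: nm.
have fa n s : sorted ltn s -> size s = r -> all (ltn n) s ->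
    f (a n :: map a s) = col n.
  move=> ss sr ns.
  have /choice[k kP] m : exists k, n < m -> a m = H n.+1 k.
    by case: (ltnP n m) => [/aH[k]|]; [exists k|exists 0].
  have -> : map a s = map (H n.+1) (map k s).
    by rewrite -map_comp; apply/eq_in_map => m /(allP ns) /kP.
  have [_ stepn] := stepP (H n).
  apply: (stepn (map k s)); last by rewrite size_map.
  apply: (homo_sorted_in (P := ltn n)) ss; last exact: ns.
  move=> i j ni nj ij.
  suff: H n.+1 (k i) < H n.+1 (k j) by rewrite Hle.
  by rewrite -!kP //; apply: ai.
have [d [g gi gd]] := infinite_pigeonhole col.
exists (a \o g) => [m n mn|]; first by apply/ai/gi.
exists d => -[//|x s] /= xs [sr]; rewrite -(gd x) -(fa (g x) (map g s)) ?size_map //.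
- by rewrite map_comp.
- by apply: (homo_sorted gi); apply: path_sorted xs.
- by rewrite all_map; apply: sub_all (order_path_min ltn_trans xs) => m /gi.
Qed.

(* Indiscernibility over a sequence of columns, for all configurations at once. *)
Lemma ramsey_order (I c : finType) (F : (I -> nat) -> c) :
  exists2 h : nat -> nat, {homo h : m n / m < n} &
    forall g g' : I -> nat, (forall i j, (g i < g j) = (g' i < g' j)) ->
      F (h \o g) = F (h \o g').
Proof.
pose r := #|I|.
(* The colour of a set records [F] at all ways of assigning its elements to [I], so that one
   application of Ramsey's theorem covers all order types. *)
pose colour K : {ffun {ffun I -> 'I_r} -> c} :=
  [ffun rho : {ffun I -> 'I_r} => F (fun i => nth 0 K (rho i))].
have [h hi [col hcol]] := ramsey r colour; exists h => // g g' gg'.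
pose K0 (k : I -> nat) := sort leq (undup (map k (enum I))).
have mK0 k i : k i \in K0 k by rewrite mem_sort mem_undup map_f ?mem_enum.
have sK0 k : sorted ltn (K0 k).
  by rewrite ltn_sorted_uniq_leq sort_uniq undup_uniq sort_sorted //; exact: leq_total.
have szK0 k : size (K0 k) <= r.
  by rewrite size_sort (leq_trans (size_undup _)) // size_map /r cardE.
(* [g] and [g'] have the same ties and the same order, so [phi] maps the values of [g] increasingly
   onto those of [g']. *)
pose phi v := if [pick i | g i == v] is Some i then g' i else 0.
have phiE i : phi (g i) = g' i.
  rewrite /phi; case: pickP => [j /eqP gji|/(_ i)/eqP//].
  by have := gg' i j; have := gg' j i; rewrite gji ltnn; lia.
have K0E : K0 g' = map phi (K0 g).
  apply: (irr_sorted_eq ltn_trans ltnn) => //.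
    apply: (homo_sorted_in (P := fun v => v \in map g (enum I))) (sK0 g).
      by move=> _ _ /mapP[i _ ->] /mapP[j _ ->]; rewrite !phiE /= -gg'.
    by apply/allP => v; rewrite mem_sort mem_undup.
  move=> v; rewrite mem_sort mem_undup; apply/mapP/mapP => [[i ii ->]|[w]].
    by exists (g i); rewrite ?phiE.
  rewrite mem_sort mem_undup => /mapP[i ii ->] ->; exists i => //.
(* [k] may take fewer than [r] values; larger numbers fill the set up to size [r] without changing
   the positions of these values. *)
pose K k := K0 k ++ iota (\max_(i : I) k i).+1 (r - size (K0 k)).
have sK k : sorted ltn (K k).
  rewrite /K; move: (sK0 k) (iota_ltn_sorted (\max_(i : I) k i).+1 (r - size (K0 k))).
  have : all (fun v => v <= \max_(i : I) k i) (K0 k).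
    apply/allP => v; rewrite mem_sort mem_undup => /mapP[i _ ->].
    exact: leq_bigmax.
  case: (K0 k) => // v s /= /andP[vb sb] vs; rewrite cat_path vs /=.
  case: (r - _) => //= n ->; rewrite andbT ltnS.
  have : last v s \in v :: s by rewrite mem_last.
  by rewrite inE => /orP[/eqP->//|/(allP sb)].
have szK k : size (K k) = r by rewrite size_cat size_iota subnKC.
have idx i : index (g i) (K0 g) < r by rewrite (leq_trans _ (szK0 g)) // index_mem.
pose rho : {ffun I -> 'I_r} := [ffun i => Ordinal (idx i)].
have E k : (forall i, nth 0 (K0 k) (index (g i) (K0 g)) = k i) ->
    size (K0 k) = size (K0 g) -> F (h \o k) = col rho.
  move=> nk sk; rewrite -(hcol (K k)) // ffunE; congr F; apply/funext => i /=.
  rewrite ffunE /= (nth_map 0) ?szK // nth_cat sk.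
  by rewrite index_mem mK0 nk.
rewrite !E ?K0E ?size_map // => i; last by rewrite nth_index.
by rewrite (nth_map 0) ?index_mem // nth_index.
Qed.

End Ramsey.

(** * Patterns *)

(** The array in the definition of the dp-rank: [eta] is a path through it, [J] selects rows and [N]
    columns. Finite widths are allowed for the sake of compactness. *)
Definition pattern_on (I : Type) (Y : I -> Type) X (A : X -> Prop)
    (phi : forall i, X -> Y i -> Prop) (J : pred I) (N : pred nat) :=
  exists b : forall i, nat -> Y i, forall eta : I -> nat, (forall i, N (eta i)) ->
    exists2 x, A x & forall i, J i -> forall j, N j -> (phi i x (b i j) <-> j = eta i).

Lemma pattern_onS (I : Type) (Y : I -> Type) X (A : X -> Prop)
    (phi : forall i, X -> Y i -> Prop) (J J' : pred I) (N N' : pred nat) :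
  {subset J' <= J} -> {subset N' <= N} ->
  pattern_on A phi J N -> pattern_on A phi J' N'.
Proof.
move=> JJ NN [b bP]; exists b => eta eN; have [|x Ax xP] := bP eta.
  by move=> i; apply/NN/eN.
by exists x => // i /JJ Ji j /NN Nj; apply: xP.
Qed.

Unset Implicit Arguments.

(** * Compactness for patterns *)

Section Compactness.
Variables (L : language) (M : structure L).
Local Notation S := (lsort L).
Hypothesis M_saturated : saturated M.
Variables (Vp Vx : finType) (P : Vp -> S) (X : Vx -> S) (I : finType)
  (Vi : I -> finType) (y : forall i, Vi i -> S) (J : pred I).
Variables (Z : env M P -> env M X -> Prop)
  (phi : forall i, env M P -> env M X -> env M (y i) -> Prop).
Hypotheses (dZ : fdef2 Z) (dphi : forall i, fdef3 (phi i)).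

(* All rows are put side by side in columns, indexed by [nat]. *)
Let V := {i : I & Vi i}.
Let yC (k : V) : S := y (tag k) (tagged k).
Let col (c : env M yC) i : env M (y i) := fun v => c (Tagged Vi v).
Let yN N (k : 'I_N * V) : S := yC k.2.
Let cols N (r : env M (yN N)) (d : env M yC) (j : nat) : env M yC :=
  if insub j is Some o then fun k => r (o, k) else d.

Let PN N p (cs : nat -> env M yC) := forall eta : {ffun I -> 'I_N},
  exists x, Z p x /\ forall i, J i -> forall j : 'I_N,
    phi i p x (col (cs j) i) <-> j = eta i :> nat.

Let PN_le N N' p cs cs' : N <= N' -> (forall j, j < N -> cs j = cs' j) ->
  PN N' p cs' -> PN N p cs.
Proof.
move=> NN e H eta; have [x [Zx xP]] := H [ffun i => widen_ord NN (eta i)].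
exists x; split=> // i Ji j; have := xP i Ji (widen_ord NN j).
by rewrite /= ffunE /= e.
Qed.

Let unc N (r : nat -> env M yC) : env M (yN N) := fun k => r k.1 k.2.

Let colsE N (r : nat -> env M yC) d j :
  j < N -> cols N (unc N r) d j = r j.
Proof. by move=> jN; rewrite /cols insubT. Qed.

Let dPN N W (w : W -> S) (f : env M w -> env M P) (g : env M w -> nat -> env M yC) :
  tmap f -> (forall j, tmap (fun a => g a j)) -> fdef (fun a => PN N (f a) (g a)).
Proof.
move=> tf tg; rewrite /PN.
have tf' : tmap (fun a : env M (csum w X) => f (fun v => a (inl v))).
  by move=> v; apply: (tdef_tmap (f := fun a v => a (inl v)) (tf v)); tm.
have tg' j : tmap (fun a : env M (csum w X) => g (fun v => a (inl v)) j).
  by move=> v; apply: (tdef_tmap (f := fun a v => a (inl v)) (tg j v)); tm.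
by fd=> //; move=> v; exact: (tg' _ (Tagged Vi v)).
Qed.

(** Saturation realizes finitely many variables at a time. It is applied to the parameters [p], then
    to the columns one by one, and finally, for each path, to the point on it. *)
Lemma pattern_compactness :
  (forall N, exists p, pattern_on (Z p) (fun i => phi i p) J (gtn N)) ->
  exists p, pattern_on (Z p) (fun i => phi i p) J predT.
Proof.
move=> H.
have {}H N : exists p cs, PN N p cs.
  have [p [b bP]] := H N; exists p, (fun j k => b (tag k) j (tagged k)) => eta.
  have [//|x Zx xP] := bP (fun i => eta i).
    by move=> i; apply: ltn_ord.
  by exists x; split=> // i Ji j; apply: xP => //; apply: ltn_ord.
have dcols N W (w : W -> S) (f : env M w -> env M (yN N)) (g : env M w -> env M yC) j :
    tmap f -> tmap g -> tmap (fun a => cols N (f a) (g a) j).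
  by move=> tf tg k; rewrite /cols; case: insub => [o|]; [exact: (tf (o, k))|exact: tg].
have [p pP] : exists p, forall N, exists cs, PN N p cs.
  have [_ [cs0 _]] := H 0; pose d := cs0 0.
  pose A N := [set p | exists r, PN N p (cols N r d)].
  have [||N|p pA] := countable_saturation M_saturated (A := A); last first.
  - by exists p => N; have [r rP] := pA N; exists (cols N r d).
  - have [p [cs cP]] := H N; exists p, (unc N cs).
    by apply: PN_le cP => // j jN; rewrite colsE.
  - move=> N p [r rP]; exists (unc N (cols N.+1 r d)).
    by apply: PN_le rP => // j jN; rewrite colsE.
  move=> N; rewrite /A.
  apply: (definable_fibre (P := fun p d => exists r, PN N p (cols N r d))) => //.
  by fd; apply: dPN; [tm|move=> j; refine (dcols _ _ _ _ _ _ _ _); tm].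
(* Invariant of the choice of columns: the first [m] of them extend to patterns of every finite
   width. *)
pose Q m cs := forall N, exists cs', (forall j, j < m -> cs' j = cs j) /\ PN N p cs'.
pose asm m (a : nat -> env M yC) c (r : nat -> env M yC) j :=
  if j < m then a j else if j == m then c else r (j - m.+1).
have step m a : exists c, Q m a -> Q m.+1 (asm m a c a).
  have [Qa|nQ] := pselect (Q m a); last by exists (a 0) => /nQ.
  pose A N := [set c | exists r, PN (m.+1 + N) p (asm m a c (cols N r c))].
  have [||N|c cA] := countable_saturation M_saturated (A := A); last first.
  - exists c => _ N; have [r rP] := cA N.
    exists (asm m a c (cols N r c)); split.
      move=> j jm; rewrite /asm; case: ltngtP => //; move: jm; rewrite ltnS; lia.
    by apply: PN_le rP => //; lia.
  - have [cs [csa cP]] := Qa (m.+1 + N); exists (cs m), (unc N (fun j => cs (m.+1 + j))).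
    apply: PN_le cP => // j jN; rewrite /asm; case: ltngtP => [/csa//|jm|->//].
    by rewrite colsE ?subnKC //; lia.
  - move=> N c [r rP]; exists (unc N (cols N.+1 r c)).
    apply: PN_le rP => [|j jN]; first by lia.
    by rewrite /asm; case: ltngtP => // jm; rewrite colsE //; lia.
  move=> N; rewrite /A.
  pose R c (b : env M (csum P (yN m))) :=
    exists r, PN (m.+1 + N) (fun v => b (inl v))
      (asm m (cols m (fun v => b (inr v)) c) c (cols N r c)).
  rewrite (_ : [set _ | _] = [set c | R c (ecat p (unc m a))]); last first.
    apply/seteqP; split=> c [r rP]; exists r; apply: PN_le rP => // j _;
      by rewrite /asm; case: ifP => // jm; rewrite (colsE m a).
  apply: (definable_fibre (P := R)) => //; rewrite /R; fd; apply: dPN; first by tm.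
  move=> j; rewrite /asm; case: (j < m); first by refine (dcols _ _ _ _ _ _ _ _); tm.
  by case: (j == m); [tm|refine (dcols _ _ _ _ _ _ _ _); tm].
have /choice[ch chP] (ma : nat * (nat -> env M yC)) :
    exists c, Q ma.1 ma.2 -> Q ma.1.+1 (asm ma.1 ma.2 c ma.2) by apply: step.
have [_ [cs0 _]] := H 0.
pose F := fix F m := if m is m'.+1 then asm m' (F m') (ch (m', F m')) (F m') else cs0.
have QF m : Q m (F m).
  elim: m => [N|m IH]; last exact: (chP (m, F m)).
  by have [cs csP] := pP N; exists cs.
pose c j := F j.+1 j.
have Fc m j : j < m -> F m j = c j.
  elim: m => // m IH; rewrite ltnS leq_eqVlt => /orP[/eqP->//|jm] /=.
  by rewrite /asm jm IH.
have cP N : PN N p c.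
  have [cs [csF csP]] := QF N N; apply: PN_le csP => // j jN.
  by rewrite csF // Fc.
exists p, (fun i j => col (c j) i) => eta _.
pose A N := [set x | Z p x /\ forall i, J i -> forall j : 'I_N,
   phi i p x (col (cols N (unc N c) (c 0) j) i) <-> j = eta i :> nat].
have [||N|x xA] := countable_saturation M_saturated (A := A); last first.
- exists x => [|i Ji j _]; first by case: (xA 0).
  by have [_ /(_ i Ji (Ordinal (ltnSn j)))] := xA j.+1; rewrite colsE.
(* [N'] exceeds all values of [eta], so that [eta] is a path through the pattern of width [N']. *)
- pose N' := maxn N (\max_i eta i).+1.
  have eN i : eta i < N' by rewrite /N' leq_max orbC ltnS leq_bigmax.
  have [x [Zx xP]] := cP N' [ffun i => Ordinal (eN i)].
  have NN' : N <= N' by rewrite leq_maxl.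
  exists x; split=> // i Ji j; rewrite colsE ?ltn_ord //.
  by have := xP i Ji (widen_ord NN' j); rewrite ffunE.
- move=> N x [Zx xP]; split=> // i Ji j; rewrite colsE ?ltn_ord //.
  have := xP i Ji (widen_ord (leqnSn N) j); rewrite colsE // /= ltnS ltnW.
move=> N; pose R x (b : env M (csum P (csum yC (yN N)))) :=
  Z (fun v => b (inl v)) x /\ forall i, J i -> forall j : 'I_N,
   phi i (fun v => b (inl v)) x
     (col (cols N (fun v => b (inr (inr v))) (fun v => b (inr (inl v))) j) i)
   <-> j = eta i :> nat.
apply: (definable_fibre (P := R) (b := ecat p (ecat (c 0) (unc N c)))) => //.
rewrite /R; fd; move=> v; rewrite /col /cols.
by case: insub => [o|]; tvar.
Qed.
End Compactness.

Set Implicit Arguments.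

Lemma nat_sup_ub (P : set nat) n : nat_sup P = n%:E%E -> forall m, P m -> m <= n.
Proof.
rewrite /nat_sup; case: pselect => [e|_]; last by case: ifP.
by case: cid => /= k [_ kP] [<-].
Qed.

(** * Patterns and the dp-rank *)

Section DpRank.
Variables (L : language) (M : structure L).
Local Notation S := (lsort L).

(** The entries of a row are distinct, because a point on a path through one of them satisfies the
    formula of that row at no other column; so the rows are infinite sets. *)
Lemma pattern_dp_rank_gt (Vp : finType) (P : Vp -> S) V (x : V -> S) n
    (Vi : 'I_n.+1 -> finType) (y : forall i, Vi i -> S)
    (phi : forall i, env M P -> env M x -> env M (@y i) -> Prop) p (A : set (env M x)) :
  (forall i, fdef3 (@phi i)) -> pattern_on A (fun i => @phi i p) predT predT ->
  dp_rank_gt A n.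
Proof.
move=> dphi [b bP].
have /dep_choice[q qP] i : exists q : pformula M (csum x (octx (@y i))),
    forall a, psat q a <-> @phi i p (fun v => a (inl v)) (of_ord (fun v => a (inr v))).
  have [|q _ qP] := @definable_fibre _ _ setT _ (csum x (octx (@y i))) _ P (fun a p => @phi i p
    (fun v => a (inl v)) (of_ord (fun v => a (inr v)))) p _ (fun _ => I).
    have := dphi i => dphi_i; fd; move=> v.
    by apply: tdef_cast; tvar.
  by exists q => a; rewrite -[psat q a]/([set a | psat q a] a) -qP.
exists (fun i => #|Vi i|), (fun i => octx (@y i)), q, (fun i => range (fun j => to_ord (b i j))).
split=> [i|c cP].
  have inj : injective (fun j => to_ord (b i j)).
    move=> j j' /(can_inj (@to_ordK _ M _ _)) e.
    have [//|a _ aP] := bP (fun=> j).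
    by apply/esym; rewrite -(aP i isT j' isT) -e (aP i isT).
  by apply: (injection_infinite inj) => j; exists j.
have /choice[eta etaP] i : exists j, c i = to_ord (b i j).
  by have [j _ <-] := cP i; exists j.
have [//|a Aa aP] := bP eta; exists a => // i d [j _ <-].
rewrite qP /= -[X in @phi i p X _]/a -[X in @phi i p _ X]/(of_ord (to_ord (b i j))) to_ordK aP // etaP.
split=> [->//|/(can_inj (@to_ordK _ M _ _)) e].
by rewrite -(aP i isT j isT) e aP.
Qed.

Lemma dp_rank_gt_pattern V (x : V -> S) n (A : set (env M x)) : dp_rank_gt A n ->
  exists (Vp : finType) (P : Vp -> S) (p : env M P)
    (Vi : 'I_n.+1 -> finType) (y : forall i, Vi i -> S)
    (phi : forall i, env M P -> env M x -> env M (@y i) -> Prop),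
    (forall i, fdef3 (@phi i)) /\ pattern_on A (fun i => @phi i p) predT predT.
Proof.
move=> [m [y [phi [B [infB BP]]]]].
exists {i : 'I_n.+1 & 'I_(pf_n (phi i))}, (fun k => pf_ctx (phi (tag k)) (tagged k)),
  (fun k => pf_par (phi (tag k)) (tagged k)), (fun i => 'I_(m i)), y,
  (fun i (p : env M (fun k : {i : 'I_n.+1 & 'I_(pf_n (phi i))} =>
    pf_ctx (phi (tag k)) (tagged k))) a b => sat (pf_formula (phi i)) (ecat (ecat a b) (fun v => p (Tagged _ v)))).
split=> [i|].
  have dq : fdef (@sat _ M _ _ (pf_formula (phi i))) by exists (pf_formula (phi i)).
  by fd; move=> [[v|v]|v]; tvar.
have /dep_choice[b bP] i : exists b : nat -> env M (@y i), injective b /\ forall j, B i (b j).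
  by have [b] := infinite_injection (infB i); exists b.
exists b => eta _; have [|a Aa aP] := BP (fun i => b i (eta i)).
  by move=> i; case: (bP i).
exists a => // i _ j _; case: (bP i) => inj Bb.
have := aP i _ (Bb j); rewrite /psat => ->.
by split=> [/inj|->].
Qed.

Variable h : lsort L.

Definition consx d (e : M h) (x : env M (pow h d)) : env M (pow h d.+1) :=
  fun i => if unlift ord0 i is Some j then x j else e.

Lemma consxE d (x : env M (pow h d.+1)) : consx (x ord0) (fun j => x (lift ord0 j)) = x.
Proof. by apply: functional_extensionality_dep => i; rewrite /consx; case: unliftP => [j|] ->. Qed.

Lemma consx0 d e (x : env M (pow h d)) : consx e x ord0 = e.
Proof. by rewrite /consx unlift_none. Qed.

Lemma consxS d e (x : env M (pow h d)) i : consx e x (lift ord0 i) = x i.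
Proof. by rewrite /consx liftK. Qed.

Lemma tmap_consx d V (y : V -> S) e (x : env M y -> env M (pow h d)) :
  tdef e -> tmap x -> tmap (fun a => consx (e a) (x a)).
Proof. by move=> te tx i; rewrite /consx; case: unlift => [j|//]; apply: (tx j). Qed.

End DpRank.

(** * Subadditivity of the dp-rank *)

Unset Implicit Arguments.

Section Additivity.
Variables (L : language) (M : structure L) (h : lsort L).
Local Notation S := (lsort L).
Hypothesis M_saturated : saturated M.
Hypothesis M_dp_minimal : dp_rank [set: env M (pow h 1)] = 1%N%:E%E.

Lemma block_le n a c : a < c -> (n * a).*2 + n.*2 <= (n * c).*2.
Proof. by move=> ac; rewrite -doubleD leq_double addnC -mulnS leq_mul2l ac orbT. Qed.

(** By compactness, patterns of unbounded width would give two infinite rows in the home sort. *)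
Lemma dp_minimal_bound (Vp Vy : finType) (P : Vp -> S) (y : Vy -> S)
    (psi : 'I_2 -> env M P -> env M (pow h 1) -> env M y -> Prop) :
  (forall i, fdef3 (psi i)) ->
  exists N, forall p, ~ pattern_on (fun=> True) (fun i => psi i p) predT (gtn N).
Proof.
move=> dpsi; apply: contrapT => H.
have [|||p pP] := @pattern_compactness L M M_saturated Vp _ P (pow h 1) 'I_2 (fun=> Vy)
  (fun=> y) predT (fun _ _ => True) psi.
- by fd.
- exact: dpsi.
- move=> N; apply: contrapT => nP; apply: H; exists N => p pP; apply: nP; exists p.
  exact: pP.
have := pattern_dp_rank_gt dpsi pP.
by move=> /(@nat_sup_ub [set n | dp_rank_ge _ n] _ M_dp_minimal 2).
Qed.

(** * Splitting off one coordinate of a pattern *)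

Section Step.
Variables (d n0 : nat) (Vp Vw : finType) (P : Vp -> S) (W : Vw -> S) (I : finType)
  (Vi : I -> finType) (y : forall i, Vi i -> S) (J : {set I})
  (Z : env M P -> env M (pow h d.+1) -> env M W -> Prop)
  (phi : forall i, env M P -> env M (csum (pow h d.+1) W) -> env M (y i) -> Prop).
Hypotheses (dZ : fdef3 Z) (dphi : forall i, fdef3 (phi i)).

(** The first coordinate joins the parameters, which makes the induction on [d] possible. *)
Definition Z1 (p : env M (csum P (pow h 1))) (x : env M (pow h d)) (w : env M W) : Prop :=
  Z (fun v => p (inl v)) (consx (p (inr ord0)) x) w.

Definition phi1 i (p : env M (csum P (pow h 1))) (xw : env M (csum (pow h d) W))
    (b : env M (y i)) : Prop :=
  phi i (fun v => p (inl v))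
    (ecat (consx (p (inr ord0)) (fun v => xw (inl v))) (fun v => xw (inr v))) b.

Lemma fdef_Z1 : fdef3 Z1.
Proof. by rewrite /Z1; fd; apply: tmap_consx; [tvar|tm]. Qed.

Lemma fdef_phi1 i : fdef3 (phi1 i).
Proof.
rewrite /phi1; have dphi_i := dphi i; fd; apply: tmap_ecat; last by tm.
by apply: tmap_consx; [tvar|tm].
Qed.

Let N0 := n0.+1.
Let C := {i : I & ('I_N0 * Vi i)%type}.
Let yC (c : C) : S := y (tag c) (tagged c).2.
Let arr (u : env M yC) i (j : 'I_N0) : env M (y i) :=
  fun v => u (Tagged (fun i => ('I_N0 * Vi i)%type) (j, v)).

(* The rows of [J] other than [t] in the array [u] are cut out along the path
   [zeta] by a point of the fibre over [e]. *)
Definition cut (t : I) (zeta : {ffun I -> 'I_N0}) (p : env M P) (e : env M (pow h 1))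
    (u : env M yC) :=
  exists xw : env M (csum (pow h d) W),
    Z1 (ecat p e) (fun v => xw (inl v)) (fun v => xw (inr v)) /\
    forall s, s \in J :\ t -> forall j : 'I_N0,
      phi1 s (ecat p e) xw (arr u s j) <-> j = zeta s :> nat.

Lemma fdef_cut t zeta : fdef3 (cut t zeta).
Proof.
have dZ1 := fdef_Z1; have dphi1 := fdef_phi1.
rewrite /cut; fd.
by move=> v; rewrite /arr; tvar.
Qed.

Hypothesis fibre_bound : forall t, t \in J -> forall p,
  ~ pattern_on (fun xw : env M (csum (pow h d) W) => Z1 p (fun v => xw (inl v)) (fun v => xw (inr v)))
      (fun i => phi1 i p) (mem (J :\ t)) (gtn N0).

Lemma not_all_cut t p e u : t \in J -> exists zeta, ~ cut t zeta p e u.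
Proof.
move=> tJ; apply: contrapT => H; apply: (fibre_bound t tJ (ecat p e)).
exists (fun i j => arr u i (inord j)) => eta eN.
have [xw [Zxw xwP]] : cut t [ffun i => Ordinal (eN i)] p e u.
  by apply: contrapT => nc; apply: H; exists [ffun i => Ordinal (eN i)].
exists xw => // i iJ j jN; rewrite xwP // ffunE /= inordK //.
Qed.

Section Core.
Variables (p : env M P) (b : forall i, nat -> env M (y i))
  (pt : (I -> nat) -> env M (csum (pow h d.+1) W)).
Hypotheses (ptZ : forall eta, Z p (fun v => pt eta (inl v)) (fun v => pt eta (inr v)))
  (ptP : forall eta i, i \in J -> forall j, phi i p (pt eta) (b i j) <-> j = eta i).

Let e eta : env M (pow h 1) := fun _ => pt eta (inl ord0).
Let blk (k : I -> 'I_N0 -> nat) : env M yC := fun c => b (tag c) (k (tag c) (tagged c).1) (tagged c).2.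

Let F (g : I * option 'I_N0 -> nat) : {ffun I * {ffun I -> 'I_N0} -> bool} :=
  [ffun tz => `[< cut tz.1 tz.2 p (e (fun i => g (i, None))) (blk (fun i j => g (i, Some j))) >]].

Variable (hh : nat -> nat).
Hypotheses (hh_incr : {homo hh : m n / m < n})
  (hhP : forall g g', (forall q q', (g q < g q') = (g' q < g' q')) -> F (hh \o g) = F (hh \o g')).

(* Row [i] uses the columns of the [i]-th segment of length [Q]; the array
   occupies [N0] consecutive columns from [s i] on, the path goes through
   column [eta i]. *)
Let rk (i : I) : nat := enum_rank i.
Let E Q (eta : I -> nat) := e (fun i => hh (Q * rk i + eta i)).
Let U Q (s : I -> nat) := blk (fun i j => hh (Q * rk i + (s i + j))).
Let cutb Q eta s t z : bool := `[< cut t z p (E Q eta) (U Q s) >].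

Lemma rk_inj : injective rk.
Proof. by move=> i j /ord_inj /enum_rank_inj. Qed.

(** Distinct rows lie in distinct segments, so by indiscernibility only the place of the path
    relative to the array in each row matters: before it, after it, or at a given offset. *)
Lemma cutb_invariant Q eta s Q' eta' s' t z :
  (forall i, eta i < Q /\ s i + N0 <= Q) -> (forall i, eta' i < Q' /\ s' i + N0 <= Q') ->
  (forall i, [\/ eta i < s i /\ eta' i < s' i, s i + N0 <= eta i /\ s' i + N0 <= eta' i |
    eta i + s' i = eta' i + s i]) ->
  cutb Q eta s t z = cutb Q' eta' s' t z.
Proof.
move=> B B' T.
pose g Q (eta s : I -> nat) (q : I * option 'I_N0) :=
  Q * rk q.1 + (if q.2 is Some j then s q.1 + j else eta q.1).
have H := hhP (g Q eta s) (g Q' eta' s').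
have {}H : F (hh \o g Q eta s) (t, z) = F (hh \o g Q' eta' s') (t, z).
  rewrite H // => -[i o] [i' o']; rewrite /g /=.
  pose v := if o is Some j then s i + j else eta i.
  pose v' := if o' is Some j then s i' + j else eta i'.
  pose w := if o is Some j then s' i + j else eta' i.
  pose w' := if o' is Some j then s' i' + j else eta' i'.
  rewrite -/v -/v' -/w -/w'.
  have [e1|ne] := eqVneq i i'.
    rewrite /v /v' /w /w' -e1 !ltn_add2l; case: (T i) => [[]|[]|];
      case: (o) => [[j jN]|]; case: (o') => [[j' jN']|] /=; lia.
  have vQ : v < Q by rewrite /v; case: (o) => [[j jN]|] /=; case: (B i); lia.
  have vQ' : v' < Q by rewrite /v'; case: (o') => [[j jN]|] /=; case: (B i'); lia.
  have wQ : w < Q' by rewrite /w; case: (o) => [[j jN]|] /=; case: (B' i); lia.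
  have wQ' : w' < Q' by rewrite /w'; case: (o') => [[j jN]|] /=; case: (B' i'); lia.
  have rne : rk i <> rk i' by move/rk_inj => ii; rewrite ii eqxx in ne.
  by rewrite !segment_lt.
by move: H; rewrite !ffunE.
Qed.

(** The pattern's own point on the path is a witness: in every relevant row the path meets the array
    at column [z i]. *)
Lemma cutb_centered Q eta s t (z : {ffun I -> 'I_N0}) :
  (forall i, i \in J :\ t -> eta i = s i + z i) -> cutb Q eta s t z.
Proof.
move=> c; apply/asboolP.
pose path i := hh (Q * rk i + eta i).
exists (ecat (fun j => pt path (inl (lift ord0 j))) (fun v => pt path (inr v))).
have Exw : ecat (consx (pt path (inl ord0)) (fun j => pt path (inl (lift ord0 j))))
    (fun v => pt path (inr v)) = pt path.
  apply: functional_extensionality_dep => -[v|//] /=.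
  exact: (congr1 (fun x : env M (pow h d.+1) => x v) (consxE (fun v => pt path (inl v)))).
split.
  rewrite /Z1 /=; rewrite -[X in Z _ X](_ : (fun v => pt path (inl v)) = _); first exact: ptZ.
  by rewrite -(consxE (fun v => pt path (inl v))).
move=> i iJ j; rewrite /phi1 /= /E /e Exw.
have iJ' : i \in J by case/setD1P: iJ.
rewrite -[arr _ _ _]/(b i (hh (Q * rk i + (s i + j)))) ptP // /path (c i iJ).
by split=> [/(increasing_inj hh_incr)|->//]; lia.
Qed.

(** Reference configurations, with the path at [N0] in all rows: in the rows of [T] it meets the
    array at column [z i], in the others it runs just before the array. *)
Let base t (z : {ffun I -> 'I_N0}) (T : {set I}) :=
  cutb N0.*2.+2 (fun=> N0) (fun i => if i \in T then N0 - z i else N0.+1) t z.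

Lemma baseT t z (T : {set I}) : J :\ t \subset T -> base t z T.
Proof.
move=> JT; apply: cutb_centered => i /(fintype.subsetP JT) ->.
by have := ltn_ord (z i); lia.
Qed.

Lemma base0 t : t \in J -> exists z, ~~ base t z finset.set0.
Proof.
move=> tJ; have [z nz] := not_all_cut t p (E N0.*2.+2 (fun=> N0)) (U N0.*2.+2 (fun=> N0.+1)) tJ.
exists z; rewrite /base.
have -> : (fun i : I => if i \in (finset.set0 : {set I}) then N0 - z i else N0.+1) = fun=> N0.+1.
  by apply/funext => i; rewrite finset.in_set0.
exact/asboolPn.
Qed.

Let mix (T : {set I}) (v u : env M yC) : env M yC := fun c => if tag c \in T then v c else u c.

Let psi (T : {set I}) t z (p : env M P) (u : env M yC) (e : env M (pow h 1))
    (v : env M (csum yC yC)) :=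
  cut t z p e (mix T (fun c => v (inl c)) u) /\ ~ cut t z p e (mix T (fun c => v (inr c)) u).

Let dpsi T t z W0 (w : W0 -> S) f1 f2 f3 f4 :
  tmap f1 -> tmap f2 -> tmap f3 -> tmap f4 ->
  fdef (fun a : env M w => psi T t z (f1 a) (f2 a) (f3 a) (f4 a)).
Proof.
move=> t1 t2 t3 t4; have dcut := fdef_cut t z; rewrite /psi; fd => // c;
  rewrite /mix; case: (tag c \in T);
  by [exact: (t4 (inl c))|exact: (t4 (inr c))|exact: (t2 c)].
Qed.

Let N0_gt0 : 0 < N0. Proof. by []. Qed.

Ltac ar H1 H2 := move: N0_gt0 H1 H2; clear; lia.

(** A two-row pattern in the home sort is built. Its first row moves the array in row [s] and is
    read off by the test for [t]; its second moves the array in the rows outside [T] and is read off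
    by the test for [s]. *)
Lemma core_contradiction : 0 < #|J| -> False.
Proof.
case/card_gt0P => t0 t0J.
have /choice[zt ztP] t : exists z, t \in J -> ~~ base t z finset.set0.
  case: (boolP (t \in J)) => [/base0[z]|_]; first by exists z.
  by exists [ffun=> ord0].
(* Good pairs exist by [baseT], but never with empty [T], by the choice of [zt]. *)
pose good (x : I * {set I}) :=
  [&& x.1 \in J, x.2 \subset J, x.1 \notin x.2 & base x.1 (zt x.1) x.2].
have good0 : good (t0, J :\ t0).
  by rewrite /good /= t0J subD1set setD11 baseT.
case: (arg_minnP (fun x : I * {set I} => #|x.2|) good0) => -[t T] /and4P /= [tJ TJ tT gT] minT.
have [s sT] : exists s, s \in T.
  apply/finset.set0Pn; apply: contraTneq gT => ->; exact: ztP.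
have sJ : s \in J by apply: (fintype.subsetP TJ).
pose T0 := T :\ s.
have T0T : #|T0| < #|T| by rewrite /T0 (cardsD1 s T) sT.
have T0J : T0 \subset J by apply: fintype.subset_trans TJ; apply: subD1set.
(* By minimality the tests for [t] and for [s] both fail once only the rows of [T0] are met; the
   test for [t] succeeds at [T], that for [s] when all rows but [s] are met. *)
have nt : ~~ base t (zt t) T0.
  apply/negP => bT; have := minT (t, T0); rewrite /good /= tJ T0J bT leqNgt T0T.
  by rewrite in_setD1 negb_and tT orbT => /(_ isT).
have ns : ~~ base s (zt s) T0.
  apply/negP => bT; have := minT (s, T0); rewrite /good /= sJ T0J bT leqNgt T0T.
  by rewrite setD11 => /(_ isT).
have bs : base s (zt s) (~: finset.set1 s).
  by apply: baseT; rewrite finset.setDE; apply: finset.subsetIr.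
pose Ps := csum P (csum yC yC).
pose Psi (r : 'I_2) (q : env M Ps) e v :=
  if r == ord0 then psi (finset.set1 s) t (zt t) (fun c => q (inl c)) (fun c => q (inr (inl c))) e v
  else psi (~: T) s (zt s) (fun c => q (inl c)) (fun c => q (inr (inr c))) e v.
have [|N1 N1P] := dp_minimal_bound _ _ Ps (csum yC yC) Psi.
  by move=> r; rewrite /Psi; case: (r == ord0); fd; apply: dpsi; tm.
(* All moving arrays end at or before [F0]; an array placed at [F0] comes after the path. *)
pose F0 := (N0 * N1).*2.
pose Q := F0 + N0.*2.
pose start (X : {set I}) (z : {ffun I -> 'I_N0}) a i :=
  if i \in X then a else if i \in T0 then N0 - z i else F0.
pose u (z : {ffun I -> 'I_N0}) := U Q (fun i => if i \in T0 then N0 - z i else F0).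
have := N1P (ecat p (ecat (u (zt t)) (u (zt s)))); apply.
(* Each column is a pair of adjacent arrays of width [N0]; [psi] asks the test to succeed with the
   first and to fail with the second. *)
exists (fun r k => ecat (U Q (fun=> (N0 * k).*2)) (U Q (fun=> (N0 * k).*2 + N0))) => eta eN.
pose k := eta ord0; pose l := eta ord_max.
have kN : k < N1 by apply: eN.
have lN : l < N1 by apply: eN.
(* The path meets the first array of column [k] in row [s], and that of column [l] in the rows
   outside [T]; in the rows of [T0] it meets the fixed array. *)
pose H i := if i == s then (N0 * k).*2 + zt t s
  else if i \in T0 then N0 else (N0 * l).*2 + zt s i.
exists (E Q H) => // r _ j jN.
have psiE X v z a a' : psi X v z p (u z) (E Q H) (ecat (U Q (fun=> a)) (U Q (fun=> a'))) <->
    cutb Q H (start X z a) v z && ~~ cutb Q H (start X z a') v z.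
  have mixE a0 : mix X (U Q (fun=> a0)) (u z) = U Q (start X z a0).
    apply: functional_extensionality_dep => c; rewrite /mix /u /U /blk /start.
    by case: (tag c \in X).
  rewrite /psi !mixE; split=> [[/asboolP ? /asboolPn ?]|/andP[/asboolP ? /asboolPn ?]] //.
  by apply/andP.
have ztl i v : zt v i < N0 := ltn_ord _.
have kF : (N0 * k).*2 + N0.*2 <= F0 := block_le N0 k N1 kN.
have lF : (N0 * l).*2 + N0.*2 <= F0 := block_le N0 l N1 lN.
have jF : (N0 * j).*2 + N0.*2 <= F0 := block_le N0 j N1 jN.
clearbody F0.
have HQ i : H i < Q.
  rewrite /H /Q; case: eqP => _; first by ar kF (ztl s t).
  by case: ifP => _; [ar N0_gt0 N0_gt0|ar lF (ztl i s)].
have sQ X v a i : a + N0 <= Q -> start X (zt v) a i + N0 <= Q.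
  by rewrite /start /Q; case: ifP => // _ _; case: ifP => _; ar N0_gt0 N0_gt0.
have bQ (X : {set I}) (z : {ffun I -> 'I_N0}) i : N0 < N0.*2.+2 /\ (if i \in X then N0 - z i else N0.+1) + N0 <= N0.*2.+2.
  by split; [|case: ifP => _]; ar N0_gt0 N0_gt0.
have aQ : (N0 * j).*2 + N0 <= Q by rewrite /Q; ar jF N0_gt0.
have aQ' : (N0 * j).*2 + N0 + N0 <= Q by rewrite /Q; ar jF N0_gt0.
have [->|->] : r = ord0 \/ r = ord_max.
- by case: r => -[|[|//]] ri; [left|right]; apply: val_inj.
- rewrite /Psi eqxx psiE -/k.
  have [jk|jk] := eqVneq j k; last first.
    (* For [j] other than [k] both arrays lie on the same side of the path, and the test cannot
       distinguish them. *)
    suff -> : cutb Q H (start (finset.set1 s) (zt t) (N0 * j).*2) t (zt t) =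
        cutb Q H (start (finset.set1 s) (zt t) ((N0 * j).*2 + N0)) t (zt t).
      by rewrite andbN; split=> // jk'; rewrite jk' eqxx in jk.
    apply: cutb_invariant => i; [by split; [|apply: sQ]|by split; [|apply: sQ]|].
    rewrite /start /H finset.in_set1; case: eqP => [ii|_]; last by constructor 3.
    by case: (ltngtP j k) jk => // /(block_le N0) jk _; [constructor 2|constructor 1];
      split; ar jk (ztl s t).
  split=> // _; apply/andP; split.
    suff -> : cutb Q H (start (finset.set1 s) (zt t) (N0 * j).*2) t (zt t) = base t (zt t) T by [].
    apply: cutb_invariant => i; [by split; [|apply: sQ]|exact: bQ|].
    rewrite /start /H finset.in_set1 finset.in_setD1; case: eqP => [ii|_] /=.
      by rewrite ?ii sT jk; constructor 3; ar N0_gt0 (ztl s t).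
    by case: (i \in T); [constructor 3|constructor 1; split; ar lF (ztl i s)].
  suff -> : cutb Q H (start (finset.set1 s) (zt t) ((N0 * j).*2 + N0)) t (zt t) = base t (zt t) T0 by [].
  apply: cutb_invariant => i; [by split; [|apply: sQ]|exact: bQ|].
  rewrite /start /H finset.in_set1 finset.in_setD1; case: eqP => [ii|_] /=.
    by rewrite jk; constructor 1; split; ar N0_gt0 (ztl s t).
  by case: (i \in T); [constructor 3|constructor 1; split; ar lF (ztl i s)].
rewrite /Psi /= psiE -/l.
have [jl|jl] := eqVneq j l; last first.
  suff -> : cutb Q H (start (~: T) (zt s) (N0 * j).*2) s (zt s) =
      cutb Q H (start (~: T) (zt s) ((N0 * j).*2 + N0)) s (zt s).
    by rewrite andbN; split=> // jl'; rewrite jl' eqxx in jl.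
  apply: cutb_invariant => i; [by split; [|apply: sQ]|by split; [|apply: sQ]|].
  rewrite /start /H finset.in_setC finset.in_setD1; case: eqP => [ii|_] /=.
    by rewrite ?ii sT /=; constructor 3.
  case: (i \in T) => /=; first by constructor 3.
  by case: (ltngtP j l) jl => // /(block_le N0) jl _; [constructor 2|constructor 1];
    split; ar jl (ztl i s).
split=> // _; apply/andP; split.
  suff -> : cutb Q H (start (~: T) (zt s) (N0 * j).*2) s (zt s) = base s (zt s) (~: finset.set1 s) by [].
  apply: cutb_invariant => i; [by split; [|apply: sQ]|exact: bQ|].
  rewrite /start /H !finset.in_setC finset.in_setD1 finset.in_set1; case: eqP => [ii|_] /=.
    by rewrite ?ii sT /=; constructor 1; split; ar kF (ztl s t).
  by rewrite jl; case: (i \in T) => /=; constructor 3; ar N0_gt0 (ztl i s).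
suff -> : cutb Q H (start (~: T) (zt s) ((N0 * j).*2 + N0)) s (zt s) = base s (zt s) T0 by [].
apply: cutb_invariant => i; [by split; [|apply: sQ]|exact: bQ|].
rewrite /start /H finset.in_setC finset.in_setD1; case: eqP => [ii|_] /=.
  by rewrite ?ii sT /=; constructor 1; split; ar kF (ztl s t).
by rewrite jl; case: (i \in T) => /=; [constructor 3|constructor 1; split; ar lF (ztl i s)].
Qed.

End Core.
End Step.
(** Induction on [d]: the fibres over the first coordinate have [d] free coordinates left, so they
    carry no wide pattern in the rows other than [t]. The bound is uniform in [p] because the first
    coordinate becomes a parameter. *)
Lemma no_pattern d (Vp Vw : finType) (P : Vp -> S) (W : Vw -> S) (I : finType)
    (Vi : I -> finType) (y : forall i, Vi i -> S) (J : {set I})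
    (Z : env M P -> env M (pow h d) -> env M W -> Prop)
    (phi : forall i, env M P -> env M (csum (pow h d) W) -> env M (y i) -> Prop) m :
  fdef3 Z -> (forall i, fdef3 (phi i)) ->
  (forall p x, ~ atleast m (Z p x)) ->
  d < #|J| ->
  exists N, forall p, ~ pattern_on
    (fun xw : env M (csum (pow h d) W) => Z p (fun v => xw (inl v)) (fun v => xw (inr v)))
    (fun i => phi i p) (mem J) (gtn N).
Proof.
elim: d => [|d IH] in Vp P J Z phi *.
  (* Without free coordinates there are fewer than [m] points, whereas [m] columns of one row
     require [m] of them. *)
  move=> _ _ fin /card_gt0P[i0 i0J]; exists m => p [b bP].
  have /choice[xw xwP] (j : 'I_m) : exists xw : env M (csum (pow h 0) W),
      Z p (fun v => xw (inl v)) (fun v => xw (inr v)) /\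
      forall j' : 'I_m, phi i0 p xw (b i0 j') <-> j' = j :> nat.
    have [|xw Zxw xwP] := bP (fun=> j); first by move=> _; apply: ltn_ord.
    by exists xw; split=> // j'; apply: xwP => //; apply: ltn_ord.
  have x0 : env M (pow h 0) by case.
  have x0E (x : env M (pow h 0)) : x = x0 by apply: functional_extensionality_dep; case.
  apply: (fin p x0); exists (fun j v => xw j (inr v)); split.
    move=> j j' e; apply: val_inj => /=.
    have xwe : xw j = xw j'.
      apply: functional_extensionality_dep => -[[//]|v].
      exact: (congr1 (fun x : env M W => x v) e).
    by have [_ /(_ j)[_ /(_ erefl)]] := xwP j; rewrite xwe; case: (xwP j') => _ /(_ j)[].
  by move=> j; have [] := xwP j; rewrite (x0E (fun v => xw j (inl v))).
move=> dZ dphi fin dJ; apply: contrapT => H.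
have /choice[N0 N0P] t : exists N0, t \in J -> forall p, ~ pattern_on
    (fun xw : env M (csum (pow h d) W) =>
       Z1 d Vp Vw P W Z p (fun v => xw (inl v)) (fun v => xw (inr v)))
    (fun i => phi1 d Vp Vw P W I Vi y phi i p) (mem (J :\ t)) (gtn N0).
  have [tJ|] := boolP (t \in J); last by exists 0.
  have [||p x xw||N NP] := IH _ (csum P (pow h 1)) (J :\ t)
    (Z1 d Vp Vw P W Z) (phi1 d Vp Vw P W I Vi y phi).
  - exact: fdef_Z1.
  - by move=> i; apply: fdef_phi1.
  - by apply: (fin (fun v => p (inl v)) (consx (p (inr ord0)) x)).
  - by move: dJ; rewrite (cardsD1 t J) tJ.
  - by exists N.
pose n0 := \max_t N0 t.
have [||N|p [b bP]] := pattern_compactness L M M_saturated Vp _ P (csum (pow h d.+1) W) I Vi y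
  (mem J) (fun p xw => Z p (fun v => xw (inl v)) (fun v => xw (inr v))) phi.
- by fd.
- exact: dphi.
- apply: contrapT => nP; apply: H; exists N => p pP; apply: nP; exists p; exact: pP.
have /choice[pt ptP] (eta : I -> nat) : exists xw : env M (csum (pow h d.+1) W),
    Z p (fun v => xw (inl v)) (fun v => xw (inr v)) /\
    forall i, i \in J -> forall j, phi i p xw (b i j) <-> j = eta i.
  have [//|xw Zxw xwP] := bP eta.
  by exists xw; split=> // i iJ j; apply: xwP.
have [hh hi hP] := @ramsey_order _ _ (fun g : I * option 'I_n0.+1 -> nat =>
  [ffun tz : I * {ffun I -> 'I_n0.+1} => `[< cut d n0 Vp Vw P W I Vi y J Z phi tz.1 tz.2 p
    (fun _ => pt (fun i => g (i, None)) (inl ord0))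
    (fun c => b (tag c) (g (tag c, Some (tagged c).1)) (tagged c).2) >]]).
apply: (@core_contradiction d n0 Vp Vw P W I Vi y J Z phi dZ dphi _ p b pt _ _ hh hi hP).
- move=> t tJ q; have := N0P t tJ q; apply: contra_not; apply: pattern_onS => // j.
  by rewrite !inE ltnS => jN; apply: leq_trans (ltnW jN) _; apply: leq_bigmax.
- by move=> eta; case: (ptP eta).
- by move=> eta; case: (ptP eta).
- exact: leq_ltn_trans dJ.
Qed.

End Additivity.

Set Implicit Arguments.

(** * Algebraic closure *)

Section Acl.
Variables (L : language) (M : structure L) (h : lsort L).
Local Notation S := (lsort L).

Lemma fdef_ccons V (x : V -> S) s (P : env M x -> M s -> Prop) W (w : W -> S)
    (f : env M w -> env M x) (g : env M w -> M s) :
  fdef (fun a : env M (ccons s x) => P (fun v => a (Some v)) (a None)) ->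
  tmap f -> tdef g -> fdef (fun a => P (f a) (g a)).
Proof.
move=> dP tf tg; apply: (fdef_tmap (f := fun a => econs (g a) (f a)) dP).
by case=> [v|]; [exact: (tf v)|exact: tg].
Qed.

Lemma fdef_atleast V (x : V -> S) m (P : env M x -> M h -> Prop) :
  fdef (fun a : env M (ccons h x) => P (fun v => a (Some v)) (a None)) ->
  fdef (fun a => atleast m (P a)).
Proof.
move=> dP; apply: (@fdef_ext _ _ _ _ (fun a => exists w : env M (pow h m),
    (forall i j, w i = w j -> i = j) /\ forall j, P a (w j))).
  by move=> a; split=> -[w [wi wP]]; exists w.
fd; first by apply: fdef_eq; tvar.
by apply: (fdef_ccons (f := fun a v => a (inl v)) dP); [tm|tvar].
Qed.

Lemma elt_eq (u v : elt M) : u = v ->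
  exists e : projT1 u = projT1 v, projT2 v = eq_rect _ M (projT2 u) _ e.
Proof. by move=> ->; exists erefl. Qed.

(* Parameters among the coordinates [a j] with [j] in [J] are turned into variables. *)
Lemma definable_over_abstract (C : set (elt M)) k (a : env M (pow h k)) (J : pred 'I_k)
    V (x : V -> S) (D : set (env M x)) :
  definable_over (C `|` [set existT _ h (a j) | j in [set` J]]) D ->
  exists (W : finType) (y : W -> S) (c : env M y)
    (del : env M x -> env M (pow h k) -> env M y -> Prop),
  [/\ fdef3 del, forall w, C (existT _ (y w) (c w)), forall e, D e = del e a c &
   forall e a1 a2 c, (forall j, J j -> a1 j = a2 j) -> del e a1 c = del e a2 c].
Proof.
case/definable_overP => n [z [b [P [dP bC DP]]]].
pose W := {j : 'I_n | `[< C (existT _ (z j) (b j)) >]}.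
pose y (w : W) := z (val w).
have /dep_choice[g gP] j : exists g : env M (csum (pow h k) y) -> M (z j),
    [/\ tdef g, g (ecat a (fun w => b (val w))) = b j &
     forall a1 a2 c, (forall j, J j -> a1 j = a2 j) -> g (ecat a1 c) = g (ecat a2 c)].
  have [Cj|nC] := boolP `[< C (existT _ (z j) (b j)) >].
    exists (fun ac => ac (inr (exist _ j Cj))); split=> //; exact: (tdef_var _ _ (inr (exist _ j Cj : W))).
  have [//|[i Ji /elt_eq[e eb]]] := bC j; first by move/asboolPn: nC.
  move: e eb => /= e eb.
  exists (fun ac : env M (csum (pow h k) y) => eq_rect _ M (ac (inl i)) _ e); split=> //; last by move=> a1 a2 c /(_ i Ji) /= ->.
  by apply: (@tdef_cast _ _ _ _ S id h _ e (fun ac => ac (inl i))); tvar.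
exists W, y, (fun w => b (val w)), (fun e a c => P e (fun j => g j (ecat a c))); split.
- fd=> j; case: (gP j) => tg _ _.
  by apply: (tdef_tmap (f := fun ac => ecat _ _) tg) => -[v|v]; tvar.
- by move=> w; apply/asboolP/(valP w).
- move=> e; rewrite DP; congr (P e _).
  by apply: functional_extensionality_dep => j; case: (gP j).
- move=> e a1 a2 c a12; congr (P e _).
  by apply: functional_extensionality_dep => j; case: (gP j) => _ _; apply.
Qed.

Lemma acl_atleast (C : set (elt M)) e (D : set (M h)) m :
  definable_over C [set x : env M (pow h 1) | D (x ord0)] -> ~ atleast m D -> D e ->
  acl C (existT _ h e).
Proof.
move=> dD nD De; exists [set x : env M (pow h 1) | D (x ord0)]; split=> //.
have [s [_ _ sD]] := not_atleast nD.
apply: (@sub_finite_set _ _ [set (fun=> x) | x in [set` s]]); last first.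
  by apply: finite_image; apply: (@finite_seq {classic M h}).
move=> x /sD xs; exists (x ord0) => //.
by apply: functional_extensionality_dep => i; rewrite (ord1 i).
Qed.

(** The condition of having fewer than [m] solutions is built into the formula, so that the bound
    holds for all values of the variables. *)
Lemma acl_abstract (C : set (elt M)) k (a : env M (pow h k)) (J : pred 'I_k) e :
  acl (C `|` [set existT _ h (a j) | j in [set` J]]) (existT _ h e) ->
  exists (W : finType) (y : W -> S) (c : env M y) m
    (del : env M (pow h 1) -> env M (pow h k) -> env M y -> Prop),
  [/\ fdef3 del, forall w, C (existT _ (y w) (c w)),
   forall a c, ~ atleast m [set e : M h | del (fun=> e) a c],
   del (fun=> e) a c &
   forall e a1 a2 c, (forall j, J j -> a1 j = a2 j) -> del e a1 c = del e a2 c].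
Proof.
case=> D [/definable_over_abstract[W [y [c [del [ddel cC De delJ]]]]] finD eD].
have [m mD] := finite_not_atleast finD.
have nat_ : ~ atleast m [set e : M h | del (fun=> e) a c].
  move=> [w [wi wD]]; apply: mD; exists (fun j => (fun=> w j)); split=> [i j /(congr1 (fun f => f ord0))|j].
    by move/wi.
  by rewrite De; apply: wD.
exists W, y, c, m, (fun e a c => del e a c /\ ~ atleast m [set e : M h | del (fun=> e) a c]).
have m0 : 0 < m.
  by case: (posnP m) nat_ => // -> []; apply: atleast0.
split=> //.
- fd; apply: fdef_atleast.
  by apply: (fdef3_app (f := fun g _ => g None) ddel); tm.
- move=> a1 c1 aD; have [w [_ /(_ (Ordinal m0))[_]]] := aD; apply.
  by apply: atleastS aD => // e1 [].
- by split=> //; rewrite -De.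
- move=> e1 a1 a2 c1 a12; rewrite (delJ _ _ _ _ a12); congr (_ /\ ~ atleast m _).
  by apply/funext => e2 /=; apply: delJ.
Qed.

Lemma acl_mem (C : set (elt M)) (e : elt M) : C e -> acl C e.
Proof.
case: e => s e Ce; exists [set fun=> e]; split=> //.
rewrite (_ : [set fun=> e] = [set x | (fun x (y : env M (fun _ : 'I_1 => s)) => x = y) x (fun=> e)]) //.
by apply: definable_fibre => //; fd; apply: fdef_eq_env; tm.
Qed.

Lemma acl_mono (C D : set (elt M)) : C `<=` D -> acl C `<=` acl D.
Proof. by move=> CD e [X [/(definable_overS CD) dX fX eX]]; exists X. Qed.

(** Letting [b] range over a finite set definable over [C] gives a finite union of finite sets. *)
Lemma acl_trans (C : set (elt M)) (b e : M h) :
  acl (C `|` [set existT _ h b]) (existT _ h e) -> acl C (existT _ h b) ->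
  acl C (existT _ h e).
Proof.
move=> eb [Db [/definable_overP[n [z [d [P [dP dC DbP]]]]] finDb Dbb]].
have [|W [y [c [m [del [ddel cC nat_ delbe _]]]]]] :=
    @acl_abstract C 1 (fun=> b) predT e.
  by apply: acl_mono eb; apply: setUS => _ ->; exists ord0; [exact: isT|].
pose R (x : env M (pow h 1)) (cd : env M (csum y z)) := exists b' : env M (pow h 1),
  P b' (fun v => cd (inr v)) /\ del x b' (fun v => cd (inl v)).
exists [set x | R x (ecat c d)]; split; last by exists (fun=> b); rewrite -DbP.
  apply: (definable_fibre (P := R)); first by rewrite /R; fd.
  by case=> v; [apply: cC|apply: dC].
apply: (@sub_finite_set _ _ (\bigcup_(b' in Db) [set x | del x b' c])).
  by move=> x [b' [Pb' db']]; exists b' => //; rewrite DbP.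
apply: bigcup_finite => // b' _.
apply: (@sub_finite_set _ _ ((fun e : M h => (fun=> e) : env M (pow h 1)) @`
    [set e : M h | del (fun=> e) b' c])); last first.
  by apply: finite_image; apply: contrapT => /(infinite_atleast m)/nat_.
have E (x : env M (pow h 1)) : (fun=> x ord0) = x.
  by apply: functional_extensionality_dep => i; rewrite (ord1 i).
by move=> x dx; exists (x ord0) => /=; rewrite E.
Qed.

Definition acl_generates k (C : set (elt M)) (a : env M (pow h k)) (I : {set 'I_k}) :=
  forall i, acl (C `|` [set existT _ h (a j) | j in [set` I]]) (existT _ h (a i)).

Lemma dim_tupleP k (C : set (elt M)) (a : env M (pow h k)) :
  exists2 I : {set 'I_k}, acl_generates C a I & #|I| = dim_tuple C a.
Proof.
have : dim_tuple C a = k \/ exists2 I : {set 'I_k}, acl_generates C a I & #|I| = dim_tuple C a.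
  rewrite /dim_tuple; elim/big_ind: _ => [|m n mP nP|I /asboolP IP].
  - by left.
  - by rewrite /minn; case: ifP.
  - by right; exists I.
(* The default value of the minimum is attained by the full tuple. *)
case=> // ->; exists [set: 'I_k]%SET; last by rewrite cardsT card_ord.
by move=> i; apply: acl_mem; right; exists i => //=; rewrite finset.in_setT.
Qed.

Lemma dim_tuple_le k (C : set (elt M)) (a : env M (pow h k)) (I : {set 'I_k}) :
  acl_generates C a I -> dim_tuple C a <= #|I|.
Proof.
move=> gI; rewrite /dim_tuple; have := mem_index_enum I.
elim: (index_enum _) => // J r IH; rewrite inE big_cons => /orP[/eqP<-|/IH Ir].
  by rewrite (asboolT gI) geq_minl.
by case: ifP => // _; rewrite geq_min Ir orbT.
Qed.

(** The fibres are bounded for all parameters [c'], not only for [c], which is the form that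
    [no_pattern] takes. *)
Definition acl_piece k (C : set (elt M)) d (Q : set (env M (pow h k))) :=
  exists (W : finType) (y : W -> S) (c : env M y) (R : env M (pow h k) -> env M y -> Prop)
    (I : {set 'I_k}) m,
  [/\ fdef2 R, (forall w, C (existT _ (y w) (c w))), Q = [set a | R a c], #|I| <= d &
   forall c' x, ~ atleast m [set a | R a c' /\ forall j : 'I_#|I|, a (enum_val j) = x j]].

Lemma acl_piece0 k (C : set (elt M)) d : acl_piece C d (set0 : set (env M (pow h k))).
Proof.
exists void, (of_void S), (fun v : void => match v with end), (fun _ _ => False), finset.set0, 1.
split=> //; first by fd.
- by rewrite cards0.
- by move=> c x [w [_ /(_ ord0)[]]].
Qed.

(** The piece is the conjunction of the formulas making each coordinate algebraic over those in [I].
    A point of a fibre is coded by the position of each coordinate in a finite list of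
    candidates. *)
Lemma acl_piece_cover k (C : set (elt M)) d (a : env M (pow h k)) :
  dim_tuple C a <= d -> exists2 Q, acl_piece C d Q & Q a.
Proof.
have [I gI <-] := dim_tupleP C a => Id.
have /dep_choice[W /dep_choice[y /dep_choice[c /choice[m /dep_choice[del delP]]]]] i :=
  acl_abstract (gI i).
pose V := {i : 'I_k & W i}.
pose yV (v : V) := y (tag v) (tagged v).
pose R (b : env M (pow h k)) (c : env M yV) :=
  forall i, del i (fun=> b i) b (fun w => c (Tagged W w)).
pose mm := (\max_i m i).+1.
exists [set b | R b (fun v => c (tag v) (tagged v))]; last by move=> i; case: (delP i).
exists V, yV, (fun v => c (tag v) (tagged v)), R, I, #|{ffun 'I_k -> 'I_mm}|.+1; split=> //.
- rewrite /R; apply: fdef2I; apply: fdef_forall => i; have [ddel _ _ _ _] := delP i.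
  by fd.
- by case=> i w; have [_ cC _ _ _] := delP i; apply: cC.
move=> c' x [b [bi bP]].
have /dep_choice[s sP] i : exists s : seq {classic M h}, size s < m i /\
    forall e : M h, del i (fun=> e) (b ord0) (fun w => c' (Tagged W w)) <-> (e : {classic M h}) \in s.
  have [_ _ nat_ _ _] := delP i.
  by have [s [_ sm sP]] := not_atleast (nat_ (b ord0) (fun w => c' (Tagged W w))); exists s.
have bs j i : (b j i : {classic M h}) \in s i.
  have [_ _ _ _ delJ] := delP i; case: (sP i) => _ <-.
  (* The candidates depend only on the coordinates in [I], which all points of the fibre share. *)
  rewrite (delJ _ _ (b j)); first by case: (bP j) => /(_ i).
  move=> l /= lI; have [_ e0] := bP ord0; have [_ ej] := bP j.
  by rewrite -(enum_rankK_in lI lI) e0 ej.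
pose f (j : 'I_#|{ffun 'I_k -> 'I_mm}|.+1) : {ffun 'I_k -> 'I_mm} :=
  [ffun i => inord (index (b j i : {classic M h}) (s i))].
have : injective f.
  move=> j j' /ffunP ff; apply: bi; apply: functional_extensionality_dep => i.
  have := congr1 val (ff i); rewrite !ffunE /=.
  have lt j1 : index (b j1 i : {classic M h}) (s i) < mm.
    rewrite ltnS; apply: leq_trans (leq_bigmax i); apply/ltnW.
    by apply: leq_ltn_trans (_ : size (s i) < m i); [rewrite index_size|case: (sP i)].
  rewrite !inordK // => e.
  have E j1 : nth (b j i : {classic M h}) (s i) (index (b j1 i : {classic M h}) (s i)) = b j1 i.
    exact: nth_index.
  by rewrite -[LHS]E e E.
by move/leq_card; rewrite card_ord ltnn.
Qed.

End Acl.

(** * The dp-rank is at most the acl-dimension *)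

Section DpRankAcl.
Variables (L : language) (M : structure L) (h : lsort L).
Local Notation S := (lsort L).
Hypothesis M_saturated : saturated M.
Hypothesis M_dp_minimal : dp_rank [set: env M (pow h 1)] = 1%N%:E%E.

Lemma acl_piece_definable k (C : set (elt M)) d (Q : set (env M (pow h k))) :
  acl_piece C d Q -> definable_over C Q.
Proof. by move=> [W [y [c [R [I [m [dR cC -> _ _]]]]]]]; apply: definable_fibre. Qed.

Lemma definable_overC (C : set (elt M)) V (x : V -> S) (A : set (env M x)) :
  definable_over C A -> definable_over C (~` A).
Proof.
move=> /definable_overP[n [y [b [P [dP bC AP]]]]].
rewrite (_ : ~` A = [set a | (fun a b => ~ P a b) a b]); last first.
  by apply/seteqP; split=> a; rewrite /setC /= AP.
by apply: (definable_fibre (P := fun a b => ~ P a b)) => //; fd.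
Qed.

(** Otherwise [A] and the complements of all pieces form a finitely satisfiable type over [C], but a
    realization lies in a piece by [acl_piece_cover]. *)
Lemma finite_acl_cover k (C : set (elt M)) d (A : set (env M (pow h k))) :
  small C -> definable_over C A -> (forall a, A a -> dim_tuple C a <= d) ->
  exists n (Q : 'I_n -> set (env M (pow h k))),
    (forall i, acl_piece C d (Q i)) /\ forall a, A a -> exists i, Q i a.
Proof.
move=> smC dA Ad; apply: contrapT => H.
pose Sigma : set (pformula M (pow h k)) := [set q | formula_over C q /\
  (A `<=` [set a | psat q a] \/ exists2 Q, acl_piece C d Q & [set a | psat q a] = ~` Q)].
have [a aS] : exists a, forall q, Sigma q -> psat q a.
  apply: (M_saturated smC) => [q [] //|F FS /(@finite_seqP {classic _})[s sF]].
  have /choice[Qf QfP] (q : pformula M (pow h k)) : exists Q, acl_piece C d Q /\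
      (Sigma q -> forall a, A a -> ~ Q a -> psat q a).
    have [[Q pQ qQ]|nQ] := EM (exists2 Q, acl_piece C d Q & [set a | psat q a] = ~` Q).
      by exists Q; split=> // _ a _ nQa; rewrite -[psat q a]/([set a | psat q a] a) qQ.
    exists set0; split; first exact: acl_piece0.
    by case=> _ [Aq a Aa _|//]; apply: Aq.
  apply: contrapT => nF; apply: H.
  exists (size s), (fun i => Qf (tnth (in_tuple s) i)); split=> [i|a Aa].
    by case: (QfP (tnth (in_tuple s) i)).
  apply: contrapT => nQ; apply: nF; exists a => q Fq; case: (QfP q) => _; apply=> //.
    exact: FS.
  move=> Qa; apply: nQ; have qs : (q : {classic _}) \in s by move: Fq; rewrite sF.
  have [i qi] := seq_tnthP qs; by exists i; rewrite -qi.
have Aa : A a.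
  have [q qC Aq] := dA; rewrite Aq; apply: aS; split=> //; left.
  by rewrite -Aq.
have [Q pQ Qa] := acl_piece_cover (Ad a Aa).
have [q qC qQ] := definable_overC (acl_piece_definable pQ).
have : [set a | psat q a] a by apply: aS; split=> //; right; exists Q.
by rewrite -qQ.
Qed.

(** Otherwise finitely many pieces cover [A]. Ramsey's theorem puts a wide pattern into one piece,
    which has too few free coordinates for [d.+1] rows. *)
Lemma dp_rank_gt_acl k (C : set (elt M)) d (A : set (env M (pow h k))) :
  small C -> definable_over C A -> dp_rank_gt A d ->
  exists2 a, A a & d < dim_tuple C a.
Proof.
move=> smC dA gtA; apply: contrapT => H.
have [a Aa|n [Q [pQ AQ]]] := finite_acl_cover (d := d) smC dA.
  by rewrite leqNgt; apply/negP => da; apply: H; exists a.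
have [Vp [P [p [Vi [y [phi [dphi [b bP]]]]]]]] := dp_rank_gt_pattern gtA.
have /choice[N NP] l : exists N, ~ pattern_on (Q l) (fun i => phi i p) predT (gtn N).
  have [W [z [c [R [I [m [dR _ QR Id Rm]]]]]]] := pQ l.
  have [|||| N NP] := no_pattern L M h M_saturated M_dp_minimal #|I| _ _ (csum P z) (pow h k) _
    Vi y [set: 'I_d.+1]%SET (fun q x w => R w (fun v => q (inr v)) /\ forall j : 'I_#|I|, w (enum_val j) = x j)
    (fun i q xw b => phi i (fun v => q (inl v)) (fun v => xw (inr v)) b) m.
  - by fd; apply: fdef_eq; tvar.
  - by move=> i; have dphi_i := dphi i; fd.
  - by move=> q x; apply: Rm.
  - by rewrite cardsT card_ord ltnS.
  exists N => -[b' b'P]; apply: (NP (ecat p c)); exists b' => eta eN.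
  have [w Qw wP] := b'P eta eN; move: Qw; rewrite QR => Rw.
  exists (ecat (fun j : 'I_#|I| => w (enum_val j)) w) => //.
  by move=> i _ j jN; apply: wP.
pose N0 := \max_l N l.
have /choice[pt ptP] (eta : 'I_d.+1 -> nat) : exists a, A a /\
    forall i j, phi i p a (b i j) <-> j = eta i.
  by have [//|a Aa aP] := bP eta; exists a; split=> // i j; apply: aP.
have /choice[l lP] eta : exists l, Q l (pt eta) by apply: AQ; case: (ptP eta).
have [hh hi hP] := ramsey_order l.
have hinj := increasing_inj hi.
(* With the rows in consecutive segments, all paths of bounded width have one order type, hence the
   same piece. *)
pose l0 := l (hh \o (fun i : 'I_d.+1 => N0.+1 * i)).
apply: (NP l0); exists (fun i j => b i (hh (N0.+1 * i + j))) => eta eN.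
pose g (i : 'I_d.+1) := N0.+1 * i + eta i.
exists (pt (hh \o g)).
  rewrite (_ : l0 = l (hh \o g)) //; apply: hP => i j; rewrite /g.
  have bnd i' : eta i' < N0.+1.
    by rewrite ltnS; apply: leq_trans (leq_bigmax l0); apply: ltnW; apply: eN.
  have [->|/eqP ij] := eqVneq i j; first by rewrite !ltnn.
  by rewrite segment_lt ?ltn_mul2l //; move/val_inj.
move=> i _ j jN; have [_ ->] := ptP (hh \o g).
by split=> [/hinj|->//]; rewrite /g; move/addnI.
Qed.

End DpRankAcl.

(** * The topology *)

Section UniformTopology.
Variables (T : Type) (B : uniform_base T).

Lemma ub_refl U x : ub_sets B U -> U (x, x).
Proof.
move=> BU; have : diagonal (x, x) by [].
by rewrite -(ub_diag B) => /(_ U BU).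
Qed.

Lemma interiorP (X : set (uspace B)) x :
  interior X x <-> exists2 U, ub_sets B U & forall y, U (x, y) -> X y.
Proof.
rewrite /interior /= nbhsE; split=> [[O [oO Ox] OX]|[U BU UX]].
  have [U BU UO] : exists2 U, ub_sets B U & xsection U x `<=` O by apply: oO.
  by exists U => // y Uy; apply/OX/UO; rewrite /xsection /= in_setE.
exists [set y | exists2 V, ub_sets B V & forall z, V (y, z) -> X z]; last first.
  by move=> y [V BV VX]; apply: VX; apply: ub_refl BV.
split; last by exists U.
move=> y [V BV VX]; have [W BW WV] := ub_split BV; exists W => // z.
rewrite /xsection /= in_setE => Wyz; exists W => // t Wzt.
by apply/VX/WV; exists z.
Qed.

(** Boxes with one entourage for all coordinates generate a filter that converges to [b]
    coordinatewise, so it contains every neighbourhood of [b]. Conversely, a box is a finite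
    intersection of neighbourhoods. *)
Lemma interior_powP l (X : set (upow B l)) (b : upow B l) :
  interior X b <-> exists2 U, ub_sets B U & forall y : upow B l, (forall i, U (b i, y i)) -> X y.
Proof.
split=> [|[U BU UX]].
  pose F : set_system (upow B l) := [set X | exists2 U, ub_sets B U &
    forall y, (forall i, U (b i, y i)) -> X y].
  have FF : Filter F.
    split.
    - by have [U BU] := ub_neq0 B; exists U.
    - move=> P Q [U BU UP] [V BV VQ]; have [W BW WUV] := ub_meet BU BV.
      by exists W => // y Wy; split; [apply: UP|apply: VQ] => i; case: (WUV _ (Wy i)).
    - by move=> P Q PQ [U BU UP]; exists U => // y /UP/PQ.
  have : F --> b.
    apply/cvg_sup => i A [V [[W oW <-] Wb] VA].
    have [U BU UW] : exists2 U, ub_sets B U & xsection U (b i) `<=` W by apply: oW.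
    exists U => // y Uy; apply/VA/UW; rewrite /xsection /= in_setE; exact: Uy.
  exact.
have nb i : nbhs b [set y : upow B l | U (b i, y i)].
  have /cvg_sup/(_ i) : nbhs b --> b by apply: cvg_id.
  apply; have /interiorP : exists2 V, ub_sets B V & forall y, V (b i, y) -> [set y | U (b i, y)] y.
    by exists U.
  rewrite /interior /= nbhsE => -[O [oO Ob] OU].
  exists [set y : upow B l | O (y i)]; split=> //; last by move=> y /OU.
  by exists O.
have : nbhs b [set y : upow B l | forall i, U (b i, y i)].
  exact: (filter_forall (f := fun i => [set y : upow B l | U (b i, y i)]) _ nb).
by apply: filterS => y; apply: UX.
Qed.

End UniformTopology.

(** * Set pairs *)

Section SetPairs.

Lemma atleast_setU m n T (A B : set T) : atleast (m + n) (A `|` B) -> atleast m A \/ atleast n B.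
Proof.
move=> [w [wi wAB]].
pose s : seq {classic T} := codom w.
have us : uniq s by apply/injectiveP.
pose a (x : {classic T}) := `[< A x >].
have sAB : size [seq x <- s | a x] + size [seq x <- s | predC a x] = m + n.
  by rewrite !size_filter count_predC size_codom card_ord.
have [mA|Am] := leqP m (size [seq x <- s | a x]); [left|right].
  apply: (atleastS mA (D := A)) => //; apply: seq_atleast; first exact: filter_uniq.
  by move=> x; rewrite mem_filter => /andP[/asboolP].
apply: (@atleastS _ (size [seq x <- s | predC a x]) _ B); [lia|by []|].
apply: seq_atleast; first exact: filter_uniq.
move=> x; rewrite mem_filter => /andP[/= /asboolPn nA /codomP[j xj]].
by have := wAB j; rewrite -xj => -[].
Qed.

(* Bollobas' set pairs theorem, in its qualitative form. *)
Lemma set_pairs (E : eqType) n (A B : nat -> seq E) :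
  (forall i, size (A i) + size (B i) <= n) ->
  (forall i e, e \in A i -> e \notin B i) ->
  ~ forall i j, i < j -> exists e, (e \in A i) && (e \in B j) || (e \in B i) && (e \in A j).
Proof.
elim: n A B => [|n IH] A B sz disj cross.
  have [e] := cross 0 1 isT; move: (sz 0) (sz 1).
  by case: (A 0) => //; case: (B 0) => //; case: (A 1).
pose del e (s : seq E) := [seq x <- s | x != e].
have size_del e s : e \in s -> size (del e s) < size s.
  move=> es; have := count_predC (pred1 e) s; rewrite size_filter => <-.
  by rewrite -[ltnLHS]add0n ltn_add2r -has_count has_pred1.
(* Deleting an [e] common to all [X (h i)] lowers the total size and keeps the crossings, as [e]
   lies in no [Y (h i)]. *)
have sub (h : nat -> nat) e (X Y : nat -> seq E) : {homo h : i j / i < j} ->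
    (forall i, size (X i) + size (Y i) <= n.+1) ->
    (forall i e, e \in X i -> e \notin Y i) ->
    (forall i j, i < j -> exists e, (e \in X i) && (e \in Y j) || (e \in Y i) && (e \in X j)) ->
    ~ forall i, e \in X (h i).
  move=> hi sXY dXY cXY eX; apply: (IH (fun i => del e (X (h i))) (fun i => Y (h i))) => [i|i e'|i j ij].
  - by have := sXY (h i); have := size_del _ _ (eX i); lia.
  - by rewrite mem_filter => /andP[_]; apply: dXY.
  - have [e' e'P] := cXY _ _ (hi _ _ ij); exists e'.
    have ne k : e' \in Y (h k) -> e' != e.
      by apply: contraTneq => ->; apply: dXY.
    rewrite !mem_filter; case/orP: e'P => /andP[e1 e2]; first by rewrite (ne _ e2) e1 e2.
    by rewrite (ne _ e1) e1 e2 orbT.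
(* Every later pair crosses pair [0] in one of finitely many elements; infinitely many do so in the
   same element on the same side. *)
have /choice[g gP] j : exists o : 'I_(size (A 0)) + 'I_(size (B 0)), match o with
    | inl i => tnth (in_tuple (A 0)) i \in B j.+1
    | inr i => tnth (in_tuple (B 0)) i \in A j.+1 end.
  have [e /orP[/andP[e0 ej]|/andP[e0 ej]]] := cross 0 j.+1 isT.
    by have [i ei] := seq_tnthP e0; exists (inl i); rewrite -ei.
  by have [i ei] := seq_tnthP e0; exists (inr i); rewrite -ei.
have [o [h hi ho]] := infinite_pigeonhole g.
have hS : {homo (fun i => (h i).+1) : i j / i < j} by move=> i j /hi.
case: o ho => i ho.
  apply: (sub (fun i => (h i).+1) (tnth (in_tuple (A 0)) i) B A) => //.
  - by move=> k; rewrite addnC.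
  - by move=> k e; apply: contraTN => /disj.
  - by move=> k l /cross[e]; rewrite orbC; exists e.
  - by move=> k; have := gP (h k); rewrite ho.
apply: (sub (fun i => (h i).+1) (tnth (in_tuple (B 0)) i) A B) => //.
by move=> k; have := gP (h k); rewrite ho.
Qed.

End SetPairs.

(* Functions at pairwise Hamming distance at most [K]: only finitely many values
   at [x] are taken by both members of a pair at distance [K]. *)
Section HammingDiameter.
Variables (G X T : Type) (f : G -> X -> T) (Gam : set G) (K : nat).
Hypothesis diam : forall c c', Gam c -> Gam c' -> ~ atleast K.+1 [set y | f c y <> f c' y].

Lemma count_leD (U : eqType) (s : seq U) (a b c d : pred U) :
  (forall y, a y + b y <= c y + d y) -> count a s + count b s <= count c s + count d s.
Proof. by move=> H; elim: s => //= y s IH; have := H y; lia. Qed.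

Lemma diametral_values x (c c' : nat -> G) :
  (forall i, [/\ Gam (c i), Gam (c' i), atleast K [set y | f (c i) y <> f (c' i) y] &
    f (c i) x = f (c' i) x]) ->
  ~ forall i j, i < j -> f (c i) x <> f (c j) x.
Proof.
move=> H dist.
have /choice[P PP] i : exists P : seq {classic X}, [/\ uniq P, size P = K &
    forall y, (f (c i) y <> f (c' i) y) <-> (y : {classic X}) \in P].
  have [Gi Gi' far _] := H i; have [P [uP sP PP]] := not_atleast (diam Gi Gi').
  exists P; split=> //; apply/eqP; rewrite eqn_leq -ltnS sP leqNgt; apply/negP => KP.
  have [w [wi wP]] := far.
  have := @uniq_leq_size {classic X} (codom w) P; rewrite size_codom card_ord leqNgt KP.
  by move=> /(_ _ _)/notF; apply; [apply/injectiveP|move=> _ /codomP[j ->]; apply/PP/wP].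
have uP i : uniq (P i) by case: (PP i).
have sP i : size (P i) = K by case: (PP i).
have dP i (y : {classic X}) : f (c i) y <> f (c' i) y <-> y \in P i by case: (PP i).
(* The graphs of the two functions over the [K] places where they differ. A crossing of two pairs is
   a place where opposite members agree. *)
pose A i : seq ({classic X} * {classic T}) := 
    [seq (y, f (c i) y : {classic T}) | y : {classic X} <- P i].
pose B i : seq ({classic X} * {classic T}) := 
    [seq (y, f (c' i) y : {classic T}) | y : {classic X} <- P i].
apply: (@set_pairs _ (K + K) A B) => [i|i e|i j ij]; first by rewrite !size_map sP.
  move=> /mapP[y yP ->]; apply/negP => /mapP[y' _ [<- e']].
  by move/dP: yP.
apply: contrapT => ncross.
have nc (y : {classic X}) : y \in P i -> y \in P j ->
    f (c i) y <> f (c' j) y /\ f (c' i) y <> f (c j) y.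
  move=> yi yj; split=> e; apply: ncross.
    exists (y, f (c i) y : {classic T}); rewrite map_f //=.
    by apply/orP; left; apply/mapP; exists y; rewrite ?e.
  exists (y, f (c' i) y : {classic T}); rewrite orbC [X in X && _]map_f //=.
  by apply/orP; left; apply/mapP; exists y; rewrite ?e.
have xP k : (x : {classic X}) \notin P k by apply/negP => /dP; case: (H k).
pose u := undup (P i ++ P j).
have xu : (x : {classic X}) \notin u by rewrite mem_undup mem_cat negb_or !xP.
pose e1 (y : {classic X}) := `[< f (c i) y <> f (c' j) y >].
pose e2 (y : {classic X}) := `[< f (c' i) y <> f (c j) y >].
have cu k : k = i \/ k = j -> count (fun y => y \in P k) u = K.
  move=> kij; rewrite -size_filter -(sP k); apply: perm_size.
  apply: uniq_perm => //; first by rewrite filter_uniq // undup_uniq.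
  move=> y; rewrite mem_filter mem_undup mem_cat.
  by case: kij => ->; case: (y \in P _); rewrite ?orbT.
(* Without a crossing, [c i] against [c' j] and [c' i] against [c j] have at least [K + K]
   disagreements on [u] in total. *)
have : count (fun y => y \in P i) u + count (fun y => y \in P j) u <= count e1 u + count e2 u.
  apply: count_leD => y; have [yi|yi] := boolP (y \in P i); have [yj|yj] := boolP (y \in P j).
  - by have [? ?] := nc y yi yj; rewrite /e1 /e2 !asboolT.
  - have [|/asboolPn/contrapT n1] := boolP (e1 y); first by [].
    have [|/asboolPn/contrapT n2] := boolP (e2 y); first by [].
    have /contrapT n3 : ~ f (c j) y <> f (c' j) y by move/dP; apply/negP.
    by case/dP: yi; rewrite n1 -n3 n2.
  - have [|/asboolPn/contrapT n1] := boolP (e1 y); first by [].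
    have [|/asboolPn/contrapT n2] := boolP (e2 y); first by [].
    have /contrapT n3 : ~ f (c i) y <> f (c' i) y by move/dP; apply/negP.
    by case/dP: yj; rewrite -n1 n3 n2.
  - by [].
rewrite !cu; [|by right|by left].
(* Both pairs also disagree at [x], which lies outside [u]; so each has fewer than [K] disagreements
   on [u]. *)
have bound (e : pred {classic X}) d d' : Gam d -> Gam d' -> (forall y, e y -> f d y <> f d' y) ->
    e x -> count e u < K.
  move=> Gd Gd' eP ex; rewrite ltnNge; apply/negP => Ke; apply: (diam Gd Gd').
  apply: (@atleastS _ (size [seq y <- (x : {classic X}) :: u | e y]) _ [set y | f d y <> f d' y]) => //.
    by rewrite size_filter /= ex.
  apply: seq_atleast; first by rewrite filter_uniq //= xu undup_uniq.
  by move=> y; rewrite mem_filter => /andP[/eP].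
have [Gi Gi' _ xi] := H i; have [Gj Gj' _ xj] := H j; have dij := dist _ _ ij.
have b1 : count e1 u < K.
  apply: (bound _ _ _ Gi Gj'); first by move=> y /asboolP.
  by apply/asboolP; rewrite -xj.
have b2 : count e2 u < K.
  apply: (bound _ _ _ Gi' Gj); first by move=> y /asboolP.
  by apply/asboolP; rewrite -xi.
by move: b1 b2; clear; lia.
Qed.

End HammingDiameter.

(** * The acl-dimension is at most the naive dimension *)

Section AclNaive.
Variables (L : language) (M : structure L) (h : lsort L).
Local Notation S := (lsort L).
Hypothesis M_saturated : saturated M.
Variables (Vq Vz : finType) (cq : Vq -> S) (cz : Vz -> S).
Variables (U : env M cz -> M h -> M h -> Prop) (D : env M cq -> env M cz -> Prop).
Hypotheses (dU : forall V (x : V -> S) f g k, tmap f -> tdef g -> tdef k ->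
    fdef (fun a : env M x => U (f a) (g a) (k a)))
  (dD : fdef2 D).

Definition neighb (c : env M cq) (x : M h) (X : set (M h)) :=
  exists z, D c z /\ forall y, U z x y -> X y.

(** A first-order condition, so that one can quantify over all such structures. They share the
    relations [U z] and differ in the set [D c] of admissible [z]. *)
Record uniform_param (c : env M cq) : Prop := UniformParam {
  up_neq0 : exists z, D c z;
  up_refl : forall z x, D c z -> U z x x;
  up_sym : forall z x y, D c z -> U z x y -> U z y x;
  up_meet : forall z1 z2, D c z1 -> D c z2 ->
    exists z, D c z /\ forall x y, U z x y -> U z1 x y /\ U z2 x y;
  up_split : forall z, D c z -> exists z', D c z' /\
    forall x y t, U z' x y -> U z' y t -> U z x t;
  up_sep : forall x y, x <> y -> exists z, D c z /\ ~ U z x y;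
  up_crowded : forall z x, D c z -> exists y, y <> x /\ U z x y }.

Ltac fdu := repeat first [fd1 | apply dU | fapp]; try solve [tm | tvar].

Lemma fdef_uniform_param V (x : V -> S) (f : env M x -> env M cq) :
  tmap f -> fdef (fun a => uniform_param (f a)).
Proof.
move=> tf; suff dup : fdef uniform_param by fapp.
apply: (@fdef_ext _ _ _ _ (fun c => [/\ exists z, D c z,
  forall z x, D c z -> U z x x, forall z x y, D c z -> U z x y -> U z y x &
  [/\ forall z1 z2, D c z1 -> D c z2 ->
    exists z, D c z /\ forall x y, U z x y -> U z1 x y /\ U z2 x y,
   forall z, D c z -> exists z', D c z' /\
    forall x y t, U z' x y -> U z' y t -> U z x t,
   forall x y, x <> y -> exists z, D c z /\ ~ U z x y &
   forall z x, D c z -> exists y, y <> x /\ U z x y]])).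
  by move=> c; split=> [[? ? ? [? ? ? ?]]|[]].
apply: (@fdef_ext _ _ _ _ (fun c => (exists z, D c z) /\
  (forall z x, D c z -> U z x x) /\ (forall z x y, D c z -> U z x y -> U z y x) /\
  (forall z1 z2, D c z1 -> D c z2 ->
    exists z, D c z /\ forall x y, U z x y -> U z1 x y /\ U z2 x y) /\
  (forall z, D c z -> exists z', D c z' /\
    forall x y t, U z' x y -> U z' y t -> U z x t) /\
  (forall x y, x <> y -> exists z, D c z /\ ~ U z x y) /\
  forall z x, D c z -> exists y, y <> x /\ U z x y)).
  by move=> c; split=> [[? [? [? [? [? [? ?]]]]]]|[? ? ? [? ? ? ?]]].
by fdu; apply: fdef_eq; tvar.
Qed.

Lemma neighbS c x (X Y : set (M h)) : X `<=` Y -> neighb c x X -> neighb c x Y.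
Proof. by move=> XY [z [Dz zX]]; exists z; split=> // y /zX/XY. Qed.

Section UniformParamTheory.
Variables (c : env M cq) (cU : uniform_param c).

Lemma neighb_mem x (X : set (M h)) : neighb c x X -> X x.
Proof. by move=> [z [Dz]]; apply; apply: (up_refl cU). Qed.

Lemma up_meet_seq I (s : seq I) (z : I -> env M cz) : (forall i, D c (z i)) ->
  exists z0, D c z0 /\ forall x y, U z0 x y -> forall i, List.In i s -> U (z i) x y.
Proof.
move=> Dz; elim: s => [|i s [z1 [D1 z1P]]].
  by have [z0 D0] := up_neq0 cU; exists z0.
have [z0 [D0 z0P]] := up_meet cU (Dz i) D1; exists z0; split=> // x y /z0P[zi z1xy] j /= [<-//|].
exact: z1P.
Qed.

Lemma up_meet_fin (I : finType) (z : I -> env M cz) : (forall i, D c (z i)) ->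
  exists z0, D c z0 /\ forall x y, U z0 x y -> forall i, U (z i) x y.
Proof.
move=> Dz; have [z0 [D0 z0P]] := up_meet_seq (enum I) Dz; exists z0; split=> // x y /z0P H i.
apply: H; have := mem_enum I i; rewrite [RHS]/= => /idP.
by elim: (enum I) => //= j s IH; rewrite inE => /orP[/eqP->|/IH]; [left|right].
Qed.

(** A finite ball could be shrunk to its centre by separation, against [up_crowded]. *)
Lemma ball_infinite z x : D c z -> infinite_set [set y | U z x y].
Proof.
move=> Dz /(@finite_seqP {classic M h})[s sP].
have [z0 D0] := up_neq0 cU.
have /choice[w wP] (y : {classic M h}) : exists w, D c w /\ (x <> y -> ~ U w x y).
  have [->|/eqP xy] := eqVneq (x : {classic M h}) y; first by exists z0.
  by have [w [Dw nU]] := up_sep cU xy; exists w.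
have [|w1 [D1 w1P]] := @up_meet_seq _ s w; first by move=> y; case: (wP y).
have [w2 [D2 w2P]] := up_meet cU Dz D1.
have [y [yx /w2P[zxy w1xy]]] := up_crowded cU x D2.
have ys : List.In y s.
  have : [set` s] y by rewrite -sP.
  rewrite /=; elim: (s) => //= t r IH; rewrite inE => /orP[/eqP->|/IH]; [by left|by right].
have [_ nU] := wP y; apply: (nU _ (w1P _ _ w1xy _ ys)).
by move/esym.
Qed.

End UniformParamTheory.

Definition sim (x : M h) c c' := (forall z, D c z -> neighb c' x (U z x)) /\
  (forall z, D c' z -> neighb c x (U z x)).

Lemma sim_refl x c : sim x c c.
Proof. by split=> z Dz; exists z. Qed.

Lemma sim_sym x c c' : sim x c c' -> sim x c' c.
Proof. by case. Qed.

Lemma sim_neighb x c c' X : sim x c c' -> neighb c x X -> neighb c' x X.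
Proof. by move=> [cc' _] [z [Dz zX]]; apply: neighbS (cc' z Dz). Qed.

Lemma sim_trans x c1 c2 c3 : sim x c1 c2 -> sim x c2 c3 -> sim x c1 c3.
Proof.
move=> s12 s23; split=> z Dz.
  by apply: (sim_neighb s23); case: s12 => H _; apply: H.
by apply: (sim_neighb (sim_sym s12)); case: s23 => _; apply.
Qed.

(** Neighbourhood filters at [x] coded as classes of parameters; the disagreement of two structures
    becomes a Hamming distance. *)
Definition germ c x : set (env M cq) := [set c' | sim x c c'].

Lemma germP x c c' : germ c x = germ c' x <-> sim x c c'.
Proof.
split=> [e|s].
  have H : germ c' x c' := sim_refl x c'; move: H; rewrite -e; exact.
by apply/seteqP; split=> d; [apply: sim_trans (sim_sym s)|apply: sim_trans s].
Qed.

Lemma fdef_neighb V (x : V -> S) (f : env M x -> env M cq) (g : env M x -> M h)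
    (P : env M x -> M h -> Prop) :
  tmap f -> tdef g -> fdef (fun a : env M (ccons h x) => P (fun v => a (Some v)) (a None)) ->
  fdef (fun a => neighb (f a) (g a) (P a)).
Proof.
move=> tf tg dP; rewrite /neighb; fdu.
- by move=> w; apply: (tdef_tmap (f := fun a v => a (inl v)) (tf w)); tm.
- by apply: (tdef_tmap (f := fun a v => a (Some (inl v))) tg); tm.
- by apply: (fdef_ccons (f := fun a v => a (Some (inl v))) dP); [tm|tvar].
Qed.

Variable c0 : env M cq.
Hypotheses (c0_uniform : uniform_param c0)
  (c0_interior : forall X : set (M h), definable [set a : env M (pow h 1) | X (a ord0)] ->
    infinite_set X -> exists x, neighb c0 x X).

(** By saturation, [N] points can replace infinitely many, with one [N] for the whole family. *)
Lemma uniform_interior (V : finType) (x : V -> S) (P : env M x -> M h -> Prop) :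
  fdef (fun a : env M (ccons h x) => P (fun v => a (Some v)) (a None)) ->
  exists N, forall a, atleast N (P a) -> exists x0, neighb c0 x0 (P a).
Proof.
move=> dP; apply: contrapT => H.
pose R N a c := atleast N (P a) /\ ~ exists x0, neighb c x0 (P a).
have [||N|a aR] := countable_saturation M_saturated (A := fun N => [set a | R N a c0]).
- move=> N; apply: definable_fibre => //; rewrite /R; fd.
    by apply: fdef_atleast; apply: (fdef_ccons (f := fun a v => a (Some (inl v))) dP); [tm|tvar].
  by apply: fdef_neighb; [tm|tvar|apply: (fdef_ccons (f := fun a v => a (Some (Some (inl v)))) dP); [tm|tvar]].
- by move=> N a [aN nN]; split=> //; apply: atleastS aN.
- apply: contrapT => nR; apply: H; exists N => a aN; apply: contrapT => na.
  by apply: nR; exists a.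
have [_] := aR 0; apply; apply: c0_interior.
  apply: (definable_fibre (P := fun (e : env M (pow h 1)) a => P a (e ord0))) => //.
  by fd; apply: (fdef_ccons (f := fun a v => a (inr v)) dP); [tm|tvar].
by move=> /finite_not_atleast[m]; apply; case: (aR m).
Qed.

(** The interior property of [c0] quantifies over all definable sets. Two instances of it, with the
    bounds from [uniform_interior], form a definable condition that can be asked of any [c]. *)
Definition good N1 N2 c :=
  [/\ uniform_param c,
   forall c' z, atleast N1 [set x | ~ neighb c' x (U z x)] ->
     exists x, neighb c x [set x | ~ neighb c' x (U z x)] &
   forall z x0, atleast N2 (U z x0) -> exists x, neighb c x (U z x0)].

Lemma fdef_sim V (x : V -> S) (t : env M x -> M h) (f g : env M x -> env M cq) :
  tdef t -> tmap f -> tmap g -> fdef (fun a => sim (t a) (f a) (g a)).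
Proof.
move=> tt tf tg.
have tf' : tmap (fun a : env M (csum x cz) => f (fun v => a (inl v))).
  by move=> w; apply: (tdef_tmap (f := fun a v => a (inl v)) (tf w)); tm.
have tg' : tmap (fun a : env M (csum x cz) => g (fun v => a (inl v))).
  by move=> w; apply: (tdef_tmap (f := fun a v => a (inl v)) (tg w)); tm.
have tt' : tdef (fun a : env M (csum x cz) => t (fun v => a (inl v))).
  by apply: (tdef_tmap (f := fun a v => a (inl v)) tt); tm.
have tt2 : tdef (fun a : env M (ccons h (csum x cz)) => t (fun v => a (Some (inl v)))).
  by apply: (tdef_tmap (f := fun a v => a (Some (inl v))) tt); tm.
rewrite /sim; fdu => //.
  by apply: fdef_neighb => //; fdu.
by apply: fdef_neighb => //; fdu.
Qed.

Lemma fdef_good N1 N2 V (x : V -> S) (f : env M x -> env M cq) :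
  tmap f -> fdef (fun a => good N1 N2 (f a)).
Proof.
move=> tf; suff dg : fdef (good N1 N2) by fapp.
apply: (@fdef_ext _ _ _ _ (fun c => uniform_param c /\
   (forall c' z, atleast N1 (fun x => ~ neighb c' x (U z x)) ->
     exists x, neighb c x (fun x => ~ neighb c' x (U z x))) /\
   forall z x0, atleast N2 (U z x0) -> exists x, neighb c x (U z x0))).
  by move=> c; split=> [[? []]|[]].
fdu.
- by apply: fdef_uniform_param; tm.
- by apply: fdef_atleast; fdu; apply: fdef_neighb; fdu.
- by apply: fdef_neighb; fdu; apply: fdef_neighb; fdu.
- by apply: fdef_atleast; fdu.
- by apply: fdef_neighb; fdu.
Qed.

Lemma good_c0 : exists N1 N2, good N1 N2 c0.
Proof.
have [|N1 N1P] := @uniform_interior _ (csum cq cz)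
  (fun a x => ~ neighb (fun v => a (inl v)) x (U (fun v => a (inr v)) x)).
  by fdu; apply: fdef_neighb; fdu.
have [|N2 N2P] := @uniform_interior _ (csum cz (pow h 1))
  (fun a => U (fun v => a (inl v)) (a (inr ord0))).
  by fdu.
exists N1, N2; split=> // [c' z|z x0]; first exact: (N1P (ecat c' z)).
exact: (N2P (ecat z (fun=> x0))).
Qed.

Section Good.
Variables N1 N2 : nat.
Local Notation Gam := (good N1 N2).

Lemma ball_neighb c c' z x0 : uniform_param c -> Gam c' -> D c z ->
  exists x, neighb c' x (U z x0).
Proof.
by move=> cU [_ _ G] Dz; apply: G; apply: infinite_atleast; exact: (@ball_infinite c cU z x0 Dz).
Qed.

(** Otherwise, for a single [z'], [U z' x] is a neighbourhood for [c] at no point [x] of some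
    [c']-ball. A smaller [c']-ball about the same centre is a neighbourhood for [c] of one of its
    points [x], and is contained in [U z' x]. *)
Lemma differ1_bound c c' : Gam c -> Gam c' ->
  ~ atleast N1 [set x | exists z, D c' z /\ ~ neighb c x (U z x)].
Proof.
move=> Gc Gc'; have [cU _ _] := Gc; have [cU' G _] := Gc'.
move=> [w [wi /choice[z zP]]].
have [z' [Dz' z'P]] := up_meet_fin cU' (fun j => (zP j).1).
have [|x0 [z1 [D1 z1P]]] := G c z'.
  exists w; split=> // j [z2 [D2 z2P]]; case: (zP j) => _; apply.
  by exists z2; split=> // y /z2P/z'P.
have [z2 [D2 z2P]] := up_split cU' Dz'.
have [z3 [D3 z3P]] := up_meet cU' D1 D2.
have [x nx] := ball_neighb x0 cU' Gc D3.
have x0x := neighb_mem cU nx.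
apply: (z1P x); first by case: (z3P _ _ x0x).
apply: neighbS nx => y /z3P[_ x0y]; apply: z2P (up_sym cU' D2 _) x0y.
by case: (z3P _ _ x0x).
Qed.

Lemma differ_bound c c' : Gam c -> Gam c' -> ~ atleast (N1 + N1) [set x | germ c x <> germ c' x].
Proof.
move=> Gc Gc' H.
have : atleast (N1 + N1) ([set x | exists z, D c' z /\ ~ neighb c x (U z x)] `|`
    [set x | exists z, D c z /\ ~ neighb c' x (U z x)]).
  apply: atleastS H => // x /germP ns; apply: contrapT => nd; apply: ns; split=> z Dz.
    by apply: contrapT => nz; apply: nd; right; exists z.
  by apply: contrapT => nz; apply: nd; left; exists z.
by case/atleast_setU; apply: differ1_bound.
Qed.

Lemma diameter : Gam c0 -> exists K,
  (exists c c', [/\ Gam c, Gam c' & atleast K [set x | germ c x <> germ c' x]]) /\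
  forall c c', Gam c -> Gam c' -> ~ atleast K.+1 [set x | germ c x <> germ c' x].
Proof.
move=> G0.
pose P K := `[< exists c c', [/\ Gam c, Gam c' & atleast K [set x | germ c x <> germ c' x]] >].
have P0 : exists K, P K.
  by exists 0; apply/asboolP; exists c0, c0; split=> //; apply: atleast0.
have Pb K : P K -> K <= N1 + N1.
  move=> /asboolP[c [c' [Gc Gc' cK]]]; rewrite leqNgt; apply/negP => lt.
  by apply: (differ_bound Gc Gc'); apply: atleastS cK => //; apply: ltnW.
case: (ex_maxnP P0 Pb) => K /asboolP PK Kmax; exists K; split=> // c c' Gc Gc' cK.
suff /Kmax : P K.+1 by rewrite ltnn.
by apply/asboolP; exists c, c'.
Qed.

End Good.

Definition box_neighb l c (b : env M (pow h l)) (X : set (env M (pow h l))) :=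
  exists z, D c z /\ forall y : env M (pow h l), (forall i, U z (b i) (y i)) -> X y.

Lemma box_neighb_sim l c c' (b : env M (pow h l)) (X : set (env M (pow h l))) :
  uniform_param c' -> (forall i, sim (b i) c c') -> box_neighb c b X -> box_neighb c' b X.
Proof.
move=> cU' s [z [Dz zX]].
have /choice[w wP] i : exists w, D c' w /\ forall y, U w (b i) y -> U z (b i) y.
  by case: (s i) => /(_ z Dz).
have [z' [Dz' z'P]] := up_meet_fin cU' (fun i => (wP i).1).
by exists z'; split=> // y yz; apply: zX => i; case: (wP i) => _; apply; apply: z'P.
Qed.

(** Given infinitely many [e], one [z1] works for [N] of them, hence for all points of some
    [c0]-ball; with [c0]-interior points of the balls around the [a i] this gives a box for [c0]. *)
Lemma finite_fibre l (W : finType) (cw : W -> S) (P : env M (pow h l.+1) -> env M cw -> Prop)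
    d : fdef2 P -> (forall b, ~ box_neighb c0 b [set x | P x d]) ->
  forall c (a : env M (pow h l)), uniform_param c ->
    finite_set [set e | box_neighb c a [set y | P (consx e y) d]].
Proof.
move=> dP nint c a cU; apply: contrapT => inf.
have [|N NP] := @uniform_interior _ (csum (csum cz (pow h l)) cw)
  (fun q e => forall y : env M (pow h l),
     (forall i, U (fun v => q (inl (inl v))) (q (inl (inr i))) (y i)) ->
     P (consx e y) (fun v => q (inr v))).
  by fdu; apply: tmap_consx; [tvar|tm].
have [w [wi /choice[z zP]]] := infinite_atleast N inf.
have [z1 [D1 z1P]] := up_meet_fin cU (fun j => (zP j).1).
have [|e [z2 [D2 z2P]]] := NP (ecat (ecat z1 a) d).
  exists w; split=> // j y yz; case: (zP j) => _ /(_ y); apply => i.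
  exact: (z1P _ _ (yz i)).
have /choice[bw bwP] i : exists bw : M h * env M cz, D c0 bw.2 /\
    forall y, U bw.2 bw.1 y -> U z1 (a i) y.
  have [||x [w1 [Dw w1P]]] := @c0_interior (U z1 (a i)).
  - apply: (definable_fibre (P := fun (x : env M (pow h 1)) (b : env M (csum cz (pow h 1))) =>
      U (fun v => b (inl v)) (b (inr ord0)) (x ord0)) (b := ecat z1 (fun=> a i))) => //.
    by fdu.
  - exact: (@ball_infinite c cU z1 (a i) D1).
  - by exists (x, w1).
have [z3 [D3 z3P]] := up_meet_fin c0_uniform (fun i => (bwP i).1).
have [z4 [D4 z4P]] := up_meet c0_uniform D2 D3.
apply: (nint (consx e (fun i => (bw i).1))); exists z4; split=> // y yz.
rewrite /= -(consxE y); have := z2P (y ord0).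
have := z4P _ _ (yz ord0); rewrite consx0 => -[yz0 _] /(_ yz0); apply => i.
case: (bwP i) => _; apply; apply: z3P.
by have [_] := z4P _ _ (yz (lift ord0 i)); rewrite consxS.
Qed.

(** Induction on [l]. Independence makes the invariant condition [Q] fail at [a]; the induction
    hypothesis, applied to the part of the fibre where [Q] fails, yields a point where it holds. *)
Lemma independent_box l (C : set (elt M)) (X : set (env M (pow h l))) (a : env M (pow h l)) :
  definable_over C X -> X a ->
  (forall i, ~ acl (C `|` [set existT _ h (a j) | j in [set j | j != i]]) (existT _ h (a i))) ->
  exists b, box_neighb c0 b X.
Proof.
elim: l => [|l IH] in C X a *.
  move=> _ Xa _; exists a; have [z Dz] := up_neq0 c0_uniform; exists z; split=> // y _.
  by rewrite (_ : y = a) //; apply: functional_extensionality_dep; case.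
move=> dX Xa ind; apply: contrapT => nint.
have [n [cw [d [P [dP dC XP]]]]] := definable_overP dX.
have {}XP : X = [set x | P x d] by apply/funext => x; rewrite XP.
pose e := a ord0; pose a' : env M (pow h l) := fun i => a (lift ord0 i).
have [N1 [N2 G0]] := good_c0.
have [K [[c1 [c2 [G1 G2 dc]]] diam]] := diameter G0.
pose Gam := good N1 N2.
have fin c (b : env M (pow h l)) : Gam c ->
    finite_set [set e | box_neighb c b [set y | P (consx e y) d]].
  move=> [cU _ _]; apply: finite_fibre => // b0 bX; apply: nint; exists b0.
  by rewrite XP.
have simE c c' : [set x | germ c x <> germ c' x] = [set x | ~ sim x c c'].
  by apply/seteqP; split=> x; rewrite /= germP.
(* Quantifying over diametral pairs that agree at the remaining coordinates replaces [c0], so that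
   only parameters from [C] enter. *)
pose Q (x : env M (pow h l.+1)) (d : env M cw) :=
  exists c c', Gam c /\ Gam c' /\ atleast K (fun x => ~ sim x c c') /\
    (forall i : 'I_l, sim (x (lift ord0 i)) c c') /\
    exists z, D c z /\ forall y : env M (pow h l), (forall i, U z (x (lift ord0 i)) (y i)) ->
      P (consx (x ord0) y) d.
have dQ : fdef2 Q.
  rewrite /Q; fdu.
  - by apply: fdef_good; tm.
  - by apply: fdef_good; tm.
  - by apply: fdef_atleast; fdu; apply: fdef_sim; [tvar|tm|tm].
  - by apply: fdef_sim; [tvar|tm|tm].
  - by apply: tmap_consx; [tvar|tm].
have finQ : finite_set [set e | Q (consx e a') d].
  apply: contrapT => /infinite_injection[g gi gQ].
  have /choice[cc ccP] n' : exists cc : env M cq * env M cq,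
      [/\ Gam cc.1, Gam cc.2, atleast K [set t | germ cc.1 t <> germ cc.2 t],
       forall i, germ cc.1 (a' i) = germ cc.2 (a' i) &
       box_neighb cc.1 a' [set y | P (consx (g n') y) d]].
    have [c [c' [Gc [Gc' [far [close [z [Dz zP]]]]]]]] := gQ n'.
    exists (c, c'); split=> //=; first by rewrite simE.
      by move=> i; apply/germP; have := close i; rewrite consxS.
    exists z; split=> // y yz; move: (zP y); rewrite consx0; apply => i.
    by rewrite consxS.
  (* The colour is a coordinate where two germs differ. A constant colour contradicts
     [diametral_values]; if there is none, one structure serves infinitely many [e], against
     [finite_fibre]. *)
  have [hh hi [col hcol]] := ramsey 2 (fun s =>
    [pick i : 'I_l | `[< germ (cc (nth 0 s 0)).1 (a' i) <> germ (cc (nth 0 s 1)).1 (a' i) >]]).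
  case: col hcol => [i|] hcol.
    apply: (diametral_values diam (x := a' i) (c := fun k => (cc (hh k)).1) (c' := fun k => (cc (hh k)).2)).
      by move=> k; have [? ? ? close _] := ccP (hh k); split=> //; apply: close.
    move=> k k' kk; have := hcol [:: k; k']; rewrite /= kk => /(_ isT erefl).
    by case: pickP => // i' /asboolP ne [<-].
  have close k i : germ (cc (hh k.+1)).1 (a' i) = germ (cc (hh 0)).1 (a' i).
    apply: contrapT => ne; have := hcol [:: 0; k.+1] isT erefl.
    by case: pickP => // /(_ i)/asboolPn nn _; apply: nn => /esym.
  have [G _ _ _ _] := ccP (hh 0); move: (fin _ a' G).
  apply: (@injection_infinite _ _ (fun k => g (hh k.+1))) => k.
    by move=> k' /gi /(increasing_inj hi)[].
  have [_ _ _ _ box] := ccP (hh k.+1).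
  apply: box_neighb_sim box => [|i]; first by case: G.
  exact/germP.
have nQ : ~ Q a d.
  move=> Qa; apply: (ind ord0).
  have [m nm] := finite_not_atleast finQ.
  apply: (acl_atleast (m := m) (D := [set e | Q (consx e a') d])) => //; last first.
    by rewrite /= consxE.
  pose R (x : env M (pow h 1)) (b : env M (csum (pow h l) cw)) :=
    Q (consx (x ord0) (fun i => b (inl i))) (fun w => b (inr w)).
  apply: (definable_fibre (P := R) (b := ecat a' d)).
    by rewrite /R; fd; apply: tmap_consx; [tvar|tm].
  by case=> [i|w]; [right; exists (lift ord0 i)|left; apply: dC].
pose X1 (y : env M (pow h l)) (b : env M (csum (pow h 1) cw)) :=
  P (consx (b (inl ord0)) y) (fun w => b (inr w)) /\
  ~ Q (consx (b (inl ord0)) y) (fun w => b (inr w)).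
pose ed : env M (csum (pow h 1) cw) := ecat (fun=> e) d.
have [||i|b [z [Dz zP]]] := IH (C `|` [set existT _ h e]) [set y | X1 y ed] a'.
- apply: definable_fibre; first by rewrite /X1; fd; apply: tmap_consx; [tvar|tm|tvar|tm].
  by case=> [i|w]; [right|left; apply: dC].
- by rewrite /X1 /ed /= consxE; split=> //; rewrite XP in Xa.
- move=> H; apply: (ind (lift ord0 i)); apply: acl_mono H => u.
  case=> [[Cu|->]|[j /= ji <-]]; [by left|by right; exists ord0|].
  by right; exists (lift ord0 j) => //=; rewrite (inj_eq lift_inj).
have [c1U _ _] := G1.
(* Each side of the [c0]-box contains a [c1]-ball around a point where [c1] and [c2] agree, since
   balls are infinite and disagreements bounded in number. *)
have /choice[bw bwP] i : exists bw : M h * env M cz, D c1 bw.2 /\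
    (forall y, U bw.2 bw.1 y -> U z (b i) y) /\ sim bw.1 c1 c2.
  have [p [w [Dw wP]]] := ball_neighb (b i) c0_uniform G1 Dz.
  have [w' [Dw' w'P]] := up_split c1U Dw.
  have [q pq sq] : exists2 q, U w' p q & sim q c1 c2.
    apply: contrapT => nq; have := @ball_infinite c1 c1U w' p Dw'.
    move=> /(infinite_atleast (N1 + N1)) far; apply: (differ_bound G1 G2).
    by apply: atleastS far => // y wy /germP s12; apply: nq; exists y.
  exists (q, w'); split=> //; split=> //= y qy.
  by apply: wP; apply: w'P pq qy.
have [z1 [D1 z1P]] := up_meet_fin c1U (fun i => (bwP i).1).
pose b1 : env M (pow h l) := fun i => (bw i).1.
have box y : (forall i, U z1 (b1 i) (y i)) -> X1 y ed.
  by move=> yz; apply: zP => i; case: (bwP i) => _ [H _]; apply/H/z1P/yz.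
(* At the centre [b1] of the smaller box, [Q] holds by means of [c1] and [c2]. *)
have [_] := box b1 (fun i => up_refl c1U _ D1); apply.
exists c1, c2; split=> //; split=> //; split; first by move: dc; rewrite simE.
split=> [i|]; first by rewrite consxS; case: (bwP i) => _ [].
exists z1; split=> // y yz; rewrite consx0; case: (box y) => // i.
by have := yz i; rewrite consxS.
Qed.

End AclNaive.

(** * Comparison of the dimensions *)

Lemma eq_nat_sup (P Q : set nat) :
  (forall n, P n -> exists2 m, Q m & n <= m) -> (forall n, Q n -> exists2 m, P m & n <= m) ->
  nat_sup P = nat_sup Q.
Proof.
have aux (P1 P2 : set nat) n : (forall n, P1 n -> exists2 m, P2 m & n <= m) ->
    (forall n, P2 n -> exists2 m, P1 m & n <= m) ->
    P1 n /\ (forall m, P1 m -> m <= n) -> P2 n /\ (forall m, P2 m -> m <= n).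
  move=> P12 P21 [Pn nmax].
  have ub m : P2 m -> m <= n by move=> /P21[k /nmax kn mk]; apply: leq_trans kn.
  split=> //; have [m Qm nm] := P12 _ Pn.
  by rewrite (_ : n = m) //; apply/eqP; rewrite eqn_leq nm ub.
move=> PQ QP; rewrite /nat_sup.
case: pselect => [e|nP]; case: pselect => [e'|nQ].
- case: cid => m mP; case: cid => n nQ /=; have [Qm _] := aux _ _ _ PQ QP mP.
  have [Pn _] := aux _ _ _ QP PQ nQ.
  by congr (_%:E)%E; apply/eqP; rewrite eqn_leq (proj2 nQ _ Qm) (proj2 mP _ Pn).
- by case: nQ; case: e => n /(aux _ _ _ PQ QP); exists n.
- by case: nP; case: e' => n /(aux _ _ _ QP PQ); exists n.
suff -> : (P = set0) = (Q = set0) by [].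
apply/propext; split=> e; rewrite -subset0 => n.
  by move=> /QP[m]; rewrite e.
by move=> /PQ[m]; rewrite e.
Qed.

Section Main.
Variables (L : language) (h : lsort L) (M : structure L).
Local Notation S := (lsort L).
Hypothesis M_saturated : saturated M.
Variable B : uniform_base (M h).
Hypotheses (no_isolated : forall x : uspace B, ~ open [set x])
  (infinite_interior : forall X : set (M h),
     definable1 X -> infinite_set X -> interior (X : set (uspace B)) !=set0).
Variables (nz : nat) (cz : 'I_nz -> S) (phi : formula (csum (pow h 2) cz)) (p : pformula M cz).
Hypothesis BE : ub_sets B = [set [set a | sat phi (ecat (pair_env a) c)] | c in [set z | psat p z]].

Let U (z : env M cz) (x y : M h) : Prop := sat phi (ecat (pair_env (x, y)) z).
(** The parameters of the index set become variables, since other values may define further uniform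
    structures. *)
Let D (c : env M (pf_ctx p)) (z : env M cz) : Prop := sat (pf_formula p) (ecat z c).
Let c0 := pf_par p.

Let dU V (x : V -> S) f g k : tmap f -> tdef g -> tdef k ->
  fdef (fun a : env M x => U (f a) (g a) (k a)).
Proof.
move=> tf tg tk; have dphi : fdef (@sat _ M _ _ phi) by exists phi.
apply: (fdef_tmap (f := fun a => ecat (pair_env (g a, k a)) (f a)) dphi).
by case=> [i|w]; [rewrite /= /pair_env; case: (i == ord0)|exact: (tf w)].
Qed.

Let dD : fdef2 D.
Proof.
have dp : fdef (@sat _ M _ _ (pf_formula p)) by exists (pf_formula p).
by rewrite /D; fd.
Qed.

Let ubP V : ub_sets B V <-> exists2 z, D c0 z & V = [set a | U z a.1 a.2].
Proof.
have E z : [set a | sat phi (ecat (pair_env a) z)] = [set a | U z a.1 a.2].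
  by apply/seteqP; split=> -[].
rewrite BE; split=> [[z Dz <-]|[z Dz ->]]; first by exists z => //; apply: E.
by exists z => //; apply: E.
Qed.

Let c0_uniform : uniform_param U D c0.
Proof.
have Dub z : D c0 z -> ub_sets B [set a | U z a.1 a.2] by move=> Dz; apply/ubP; exists z.
split.
- by have [V /ubP[z Dz _]] := ub_neq0 B; exists z.
- by move=> z x /Dub/(ub_refl x).
- move=> z x y /Dub/(@ub_sym _ B) e Uxy.
  by have : [set a | U z a.1 a.2] (y, x) by rewrite -e.
- move=> z1 z2 /Dub D1 /Dub D2; have [W /ubP[z Dz ->] WP] := ub_meet D1 D2.
  by exists z; split=> // x y Uxy; have := WP (x, y) Uxy.
- move=> z /Dub Dz; have [W /ubP[z' Dz' ->] WP] := ub_split Dz.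
  by exists z'; split=> // x y t Uxy Uyt; apply: (WP (x, t)); exists y.
- move=> x y xy; apply: contrapT => H; apply: xy.
  suff : diagonal (x, y) by [].
  rewrite -(ub_diag B) => V /ubP[z Dz ->]; apply: contrapT => nU.
  by apply: H; exists z.
- move=> z x Dz; apply: contrapT => H; apply: (@no_isolated x).
  have : uopen ([set x] : set (uspace B)).
    move=> _ ->; exists [set a | U z a.1 a.2]; first exact: Dub.
    move=> y; rewrite /xsection /= in_setE /= => Uxy.
    by apply: contrapT => yx; apply: H; exists y.
  exact.
Qed.

Let c0_interior (X : set (M h)) : definable [set a : env M (pow h 1) | X (a ord0)] ->
  infinite_set X -> exists x, neighb U D c0 x X.
Proof.
move=> dX iX; have [x /interiorP[V /ubP[z Dz ->] VX]] := infinite_interior dX iX.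
by exists x, z; split=> // y; apply: VX.
Qed.

Let box_interior l (X : set (env M (pow h l))) b : box_neighb U D c0 b X ->
  interior (X : set (upow B l)) !=set0.
Proof.
move=> [z [Dz zX]]; exists b; apply/interior_powP.
by exists [set a | U z a.1 a.2] => //; apply/ubP; exists z.
Qed.

Variables (k : nat) (A : set (env M (pow h k))).

Let naive l := exists2 f : 'I_l -> 'I_k, injective f &
  interior [set ((fun i => a (f i)) : upow B l) | a in A] !=set0.

(** Project to a smallest generating set of coordinates: one that is algebraic over [C] and the
    others could be dropped by [acl_trans]. *)
Lemma acl_dim_naive C a : definable_over C A -> A a -> naive (dim_tuple C a).
Proof.
move=> dA Aa; have [I gI dimI] := dim_tupleP C a; rewrite -dimI.
exists enum_val; first exact: enum_val_inj.
pose X : set (env M (pow h #|I|)) := [set (fun i => a (enum_val i)) | a in A].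
have [||i H|b bX] := independent_box M_saturated dU dD c0_uniform c0_interior
  (C := C) (X := X) (a := fun i => a (enum_val i)).
- have [n [y [c [R [dR cC AR]]]]] := definable_overP dA.
  pose XR (x : env M (pow h #|I|)) c := exists a : env M (pow h k), R a c /\
    forall i : 'I_#|I|, a (enum_val i) = x i.
  have -> : X = [set x | XR x c].
    apply/seteqP; split=> [_ [a1 Aa1 <-]|x [a1 [Ra1 a1x]]].
      by exists a1; split=> //; rewrite -AR.
    exists a1; first by rewrite AR.
    by apply: functional_extensionality_dep.
  by apply: definable_fibre => //; rewrite /XR; fd; apply: fdef_eq; tvar.
- by exists a.
- pose I' := I :\ enum_val i.
  have gI' : acl_generates C a I'.
    move=> m; apply: (@acl_trans _ _ _ _ (a (enum_val i))).
      apply: acl_mono (gI m) => u [Cu|[j /= jI <-]]; first by left; left.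
      have [->|ji] := eqVneq j (enum_val i); first by right.
      by left; right; exists j => //=; rewrite in_setD1 ji.
    apply: acl_mono H => u [Cu|[j /= ji <-]]; first by left.
    right; exists (enum_val j) => //=.
    by rewrite in_setD1 (inj_eq enum_val_inj) ji enum_valP.
  have := dim_tuple_le gI'; rewrite -dimI (cardsD1 (enum_val i) I) enum_valP.
  by rewrite ltnn.
exact: box_interior bX.
Qed.

(** Row [i] consists of distinct points in the [i]-th side of a box inside the projection; its
    formula is equality with coordinate [f i]. *)
Lemma naive_dp_rank l : naive l -> dp_rank_ge A l.
Proof.
move=> [f _ [b /interior_powP[V /ubP[z Dz ->] VA]]].
case: l f b VA => [|n] f b VA.
  by have [|a Aa _] := VA b; [case|exists a].
have /choice[s sP] i : exists s : nat -> M h, injective s /\ forall j, U z (b i) (s j).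
  by have [s] := infinite_injection (ball_infinite c0_uniform (x := b i) Dz); exists s.
apply: (@pattern_dp_rank_gt _ _ void (of_void S) _ _ n (fun=> 'I_1) (fun=> pow h 1)
  (fun i _ x b => x (f i) = b ord0) (fun v : void => match v with end)).
  by move=> i; fd; apply: fdef_eq; tvar.
exists (fun i j => (fun=> s i j)) => eta _.
have [|a Aa aP] := VA (fun i => s i (eta i)); first by move=> i; exact: (sP i).2.
exists a => // i _ j _; rewrite -[a (f i)]/((fun i => a (f i)) i) aP.
by split=> [/(proj1 (sP i))->|->].
Qed.

End Main.

Unset Implicit Arguments.

Theorem proposition2p4
  (L : language) (h : lsort L) (T : set (sentence L)) (M : structure L)
  (T_complete : complete_theory T) (T_NIP : NIP T) (M_T : model T M)
  (M_saturated : saturated M)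
  (M_dp_minimal : dp_rank [set: env M (pow h 1)] = 1%N%:E)
  (B : uniform_base (M h)) (B_definable : definable_family (ub_sets B))
  (no_isolated : forall x : uspace B, ~ open [set x])
  (infinite_interior : forall X : set (M h),
     definable1 X -> infinite_set X -> interior (X : set (uspace B)) !=set0)
  (k : nat) (A : set (env M (pow h k))) (A_definable : definable A) :
  naive_dim B A = dp_rank A /\
  forall C : set (elt M), small C -> definable_over C A ->
    acl_dim C A = naive_dim B A.
Proof.
have [nz [cz [phi [D [[p _ ->] BE]]]]] := B_definable.
have main C : small C -> definable_over C A ->
    naive_dim B A = dp_rank A /\ acl_dim C A = naive_dim B A.
  move=> smC dA.
  have dp_acl n : dp_rank_ge A n -> exists2 a, A a & n <= dim_tuple C a.
    case: n => [[a Aa]|n gtA]; first by exists a.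
    by have [a Aa na] := dp_rank_gt_acl M_saturated M_dp_minimal smC dA gtA; exists a.
  have acl_naive a (Aa : A a) :=
    acl_dim_naive M_saturated no_isolated infinite_interior BE dA Aa.
  split; apply: eq_nat_sup => n.
  - by move=> /(naive_dp_rank no_isolated BE) dpn; exists n.
  - by move=> /dp_acl[a /acl_naive an na]; exists (dim_tuple C a).
  - by move=> [a /acl_naive an <-]; exists (dim_tuple C a).
  - move=> /(naive_dp_rank no_isolated BE)/dp_acl[a Aa na].
    by exists (dim_tuple C a) => //; exists a.
have [q _ Aq] := A_definable.
(* The parameters of a formula for [A] form a small set, which gives the first equality without a
   prescribed [C]. *)
have smC : small (range (fun j => existT _ (pf_ctx q j) (pf_par q j))).
  by apply: countable_small; apply: finite_set_countable; apply: finite_image; apply: finite_finset.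
split; last by move=> C smC' dA; case: (main C smC' dA).
by case: (main _ smC) => //; exists q => // j; exists j.
Qed.
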